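(* For every even integer $2n>4$ there exists an irreducible complete Einstein strictly almost Kähler manifold of real dimension $2n$.
   Context: An almost Kähler manifold is a triple $(M,g,J)$ where $g$ is a Riemannian metric on the manifold $M$ and $J$ is a $g$-orthogonal almost complex structure such that the fundamental 2-form $\Omega(\cdot,\cdot)=g(J\cdot,\cdot)$ is closed. It is strictly almost Kähler if $J$ is not integrable. It is Einstein (resp. complete) if $g$ is an Einstein (resp. complete) metric. Irreducible means irreducible as a Riemannian manifold ($(M,g)$ is not even locally a non-trivial Riemannian product). *)

(* Defs.v *)
From HB Require Import structures.
From mathcomp Require Import all_boot all_order all_algebra.
From mathcomp Require Import all_classical all_reals all_analysis.

Set Implicit Arguments.
Unset Strict Implicit.
Unset Printing Implicit Defensive.

Import Order.TTheory GRing.Theory Num.Theory.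
Import numFieldNormedType.Exports.

Local Open Scope classical_set_scope.
Local Open Scope ring_scope.

(* Tangent vectors at a point are row vectors of components in a chart, and    *)
(* matrices act on the right, as for the library's jacobian: the differential  *)
(* of f at x sends v to v *m 'J f x.                                           *)

Section Euclidean.
Context {R : realType}.

Definition partial {m : nat} {W : normedModType R} (j : 'I_m)
    (f : 'rV[R]_m -> W) : 'rV[R]_m -> W :=
  fun x => 'D_(delta_mx 0 j) f x.

(* C^oo on the open set U: differentiability of all iterated partials also     *)
(* yields their continuity.                                                    *)
Definition smooth_on {m : nat} {W : normedModType R} (U : set 'rV[R]_m)
    (f : 'rV[R]_m -> W) : Prop :=
  forall (s : seq 'I_m) (x : 'rV[R]_m), U x ->
    differentiable (foldr partial f s) x.

Definition diffeomorphism {m k : nat} (U : set 'rV[R]_m) (V : set 'rV[R]_k)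
    (f : 'rV[R]_m -> 'rV[R]_k) (f' : 'rV[R]_k -> 'rV[R]_m) : Prop :=
  [/\ open U /\ open V,
      smooth_on U f /\ smooth_on V f',
      forall x, U x -> V (f x) /\ f' (f x) = x
    & forall y, V y -> U (f' y) /\ f (f' y) = y].

(* h x is the Gram matrix of the metric at x. *)
Definition riemannian_on {m : nat} (U : set 'rV[R]_m)
    (h : 'rV[R]_m -> 'M[R]_m) : Prop :=
  smooth_on U h /\
  forall x, U x -> (h x)^T = h x /\
    forall v : 'rV[R]_m, v != 0 -> 0 < (v *m h x *m v^T) 0 0.

(* Gamma^k_(ij) *)
Definition christoffel {m : nat} (h : 'rV[R]_m -> 'M[R]_m) (k i j : 'I_m)
    (x : 'rV[R]_m) : R^o :=
  2^-1 * \sum_(l < m) invmx (h x) k l *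
    (partial i (fun y => h y j l : R^o) x + partial j (fun y => h y i l : R^o) x
     - partial l (fun y => h y i j : R^o) x).

(* The component along e_l of R(e_i, e_j) e_k, for the sign convention         *)
(* R(X, Y) = [D_X, D_Y] - D_[X, Y].                                            *)
Definition curvature {m : nat} (h : 'rV[R]_m -> 'M[R]_m) (l k i j : 'I_m)
    (x : 'rV[R]_m) : R :=
  partial i (christoffel h l j k) x - partial j (christoffel h l i k) x
  + \sum_(p < m) (christoffel h l i p x * christoffel h p j k x
                  - christoffel h l j p x * christoffel h p i k x).

Definition ricci {m : nat} (h : 'rV[R]_m -> 'M[R]_m) (x : 'rV[R]_m) : 'M[R]_m :=
  \matrix_(j, k) \sum_(i < m) curvature h i k i j x.

(* (d omega)_(ijk) = 0 for a 2-form with components omega x i j. *)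
Definition closed_2form_on {m : nat} (U : set 'rV[R]_m)
    (omega : 'rV[R]_m -> 'M[R]_m) : Prop :=
  forall x, U x -> forall i j k : 'I_m,
    partial i (fun y => omega y j k : R^o) x
    + partial j (fun y => omega y k i : R^o) x
    + partial k (fun y => omega y i j : R^o) x = 0.

(* Multiplication by sqrt(-1) on C^k, in the real coordinates (x, y) of        *)
(* z = x + sqrt(-1) y: it sends d/dx_a to d/dy_a and d/dy_a to - d/dx_a.       *)
Definition standard_J (k : nat) : 'M[R]_(k + k) :=
  block_mx 0 1%:M (- 1%:M) 0.

End Euclidean.

Record chart (R : realType) (m : nat) (T : topologicalType) := Chart {
  cdom : set T;
  ccod : set 'rV[R]_m;
  cmap : T -> 'rV[R]_m;
  cinv : 'rV[R]_m -> T;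
  cdom_open : open cdom;
  ccod_open : open ccod;
  cmap_continuous : {in cdom, continuous cmap};
  cinv_continuous : {in ccod, continuous cinv};
  cmapK : forall p, cdom p -> ccod (cmap p) /\ cinv (cmap p) = p;
  cinvK : forall x, ccod x -> cdom (cinv x) /\ cmap (cinv x) = x
}.

Definition transition (R : realType) (m : nat) (T : topologicalType)
    (c c' : chart R m T) : 'rV[R]_m -> 'rV[R]_m :=
  fun x => cmap c' (cinv c x).

Definition transition_dom (R : realType) (m : nat) (T : topologicalType)
    (c c' : chart R m T) : set 'rV[R]_m :=
  [set x | ccod c x /\ cdom c' (cinv c x)].

(* Connected smooth m-manifolds, given by an atlas that need not be maximal. *)
Record manifold (R : realType) (m : nat) := Manifold {
  points :> topologicalType;
  points_hausdorff : hausdorff_space points;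
  points_second_countable : @second_countable points;
  points_connected : connected [set: points];
  atlas_index : Type;
  atlas : atlas_index -> chart R m points;
  atlas_cover : forall p : points, exists a, cdom (atlas a) p;
  atlas_smooth : forall a b,
    smooth_on (transition_dom (atlas a) (atlas b))
              (transition (atlas a) (atlas b))
}.

Section Geometry.
Context {R : realType} {m : nat}.
Variable M : manifold R m.

(* The components, in each chart of the atlas, of a field of bilinear forms or *)
(* of endomorphisms; the values outside ccod are irrelevant.                   *)
Definition components : Type := atlas_index M -> 'rV[R]_m -> 'M[R]_m.

Definition riemannian_metric (g : components) : Prop :=
  (forall a, riemannian_on (ccod (atlas a)) (g a)) /\
  forall a b x, transition_dom (atlas a) (atlas b) x ->
    let f := transition (atlas a) (atlas b) in
    g a x = 'J f x *m g b (f x) *m ('J f x)^T.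

Definition almost_complex (J : components) : Prop :=
  (forall a, smooth_on (ccod (atlas a)) (J a)) /\
  (forall a x, ccod (atlas a) x -> J a x *m J a x = - 1%:M) /\
  forall a b x, transition_dom (atlas a) (atlas b) x ->
    let f := transition (atlas a) (atlas b) in
    J a x *m 'J f x = 'J f x *m J b (f x).

(* Components of Omega(X, Y) = g(J X, Y). *)
Definition fundamental_form (g J : components) : components :=
  fun a x => J a x *m g a x.

Definition almost_kahler (g J : components) : Prop :=
  [/\ riemannian_metric g, almost_complex J,
      forall a x, ccod (atlas a) x -> J a x *m g a x *m (J a x)^T = g a x
    & forall a, closed_2form_on (ccod (atlas a)) (fundamental_form g J a)].

(* J comes from a complex structure: around every point there are smooth       *)
(* coordinates, with values in C^k = R^(k + k), in which J is multiplication   *)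
(* by sqrt(-1).  The diffeomorphism forces k + k = m.                          *)
Definition integrable (J : components) : Prop :=
  forall p : M, exists a (U : set 'rV[R]_m) k (V : set 'rV[R]_(k + k)) f f',
    [/\ cdom (atlas a) p /\ U (cmap (atlas a) p),
        U `<=` ccod (atlas a),
        diffeomorphism U V f f'
      & forall x, U x -> J a x *m 'J f x = 'J f x *m standard_J k].

Definition strictly_almost_kahler (g J : components) : Prop :=
  almost_kahler g J /\ ~ integrable J.

Definition einstein (g : components) : Prop :=
  exists lambda : R, forall a x, ccod (atlas a) x ->
    ricci (g a) x = lambda *: g a x.

Definition in_chart (a : atlas_index M) (gamma : R -> M) : R -> 'rV[R]_m :=
  fun t => cmap (atlas a) (gamma t).

Definition C1_curve (gamma : R -> M) : Prop :=
  continuous gamma /\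
  forall a t, cdom (atlas a) (gamma t) ->
    derivable (in_chart a gamma) t 1 /\
    {for t, continuous (derive1 (in_chart a gamma))}.

(* ell is the length of gamma on [0, 1]; the speed at t is the same in every    *)
(* chart of the atlas around gamma t.                                          *)
Definition curve_length (g : components) (gamma : R -> M) (ell : R) : Prop :=
  exists speed : R -> R,
    (forall t a, t \in `[0, 1] -> cdom (atlas a) (gamma t) ->
       let v := derive1 (in_chart a gamma) t in
       speed t = Num.sqrt ((v *m g a (in_chart a gamma t) *m v^T) 0 0)) /\
    (\int[lebesgue_measure]_(t in `[0%R, 1%R]) (speed t)%:E = ell%:E)%E.

(* Lengths of the piecewise C^1 paths from p to q.  A path that is C^1 on a    *)
(* closed interval is the restriction of a C^1 curve defined on R.             *)
Inductive path_length (g : components) : M -> M -> R -> Prop :=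
| path_nil p : path_length g p p 0
| path_cons gamma ell q ell' :
    C1_curve gamma -> curve_length g gamma ell ->
    path_length g (gamma 1) q ell' ->
    path_length g (gamma 0) q (ell + ell').

Definition riemannian_dist (g : components) (p q : M) : R :=
  inf [set ell | path_length g p q ell].

(* (M, riemannian_dist g) is a complete metric space. *)
Definition complete_metric (g : components) : Prop :=
  forall u : nat -> M,
    (forall e : R, 0 < e -> exists N : nat, forall i j : nat,
       (N <= i)%N -> (N <= j)%N -> riemannian_dist g (u i) (u j) < e) ->
    exists p : M, forall e : R, 0 < e -> exists N : nat, forall i : nat,
      (N <= i)%N -> riemannian_dist g (u i) p < e.

(* p has an open neighbourhood isometric to a Riemannian product               *)
(* (V1, h1) x (V2, h2) of manifolds of positive dimension; since the property  *)
(* is local, the factors may be taken to be open sets of Euclidean spaces.     *)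
Definition locally_product_at (g : components) (p : M) : Prop :=
  exists a (U : set 'rV[R]_m) k l (V1 : set 'rV[R]_k) (V2 : set 'rV[R]_l)
      h1 h2 (f : 'rV[R]_m -> 'rV[R]_(k + l)) f',
    [/\ cdom (atlas a) p /\ U (cmap (atlas a) p),
        U `<=` ccod (atlas a),
        (0 < k)%N /\ (0 < l)%N,
        riemannian_on V1 h1 /\ riemannian_on V2 h2
      & diffeomorphism U [set y | V1 (lsubmx y) /\ V2 (rsubmx y)] f f' /\
        forall x, U x ->
          g a x = 'J f x *m block_mx (h1 (lsubmx (f x))) 0
                                     0 (h2 (rsubmx (f x))) *m ('J f x)^T].

Definition irreducible_metric (g : components) : Prop :=
  forall p : M, ~ locally_product_at g p.

End Geometry.

(* Main.v *)
Require Import Defs.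
From HB Require Import structures.
From mathcomp Require Import all_boot all_order all_algebra.
From mathcomp Require Import all_classical all_reals all_analysis.
From mathcomp Require Import ssrAC ring lra.

Set Implicit Arguments.
Unset Strict Implicit.
Unset Printing Implicit Defensive.

Import Order.TTheory GRing.Theory Num.Theory.
Import numFieldNormedType.Exports.

Local Open Scope classical_set_scope.
Local Open Scope ring_scope.

(* The example is the symmetric space SO_0(2,n) / (SO(2) x SO(n)), n >= 3, with  *)
(* its Einstein metric g, seen as a solvable group with global coordinates       *)
(* p, q, u, z, x_i, y_i (i < m, m = n - 2) and left-invariant orthonormal        *)
(* coframe                                                                       *)
(*   P = dp, Q = dq, U = c du, X_i = a dx_i, Y_i = a c (dy_i - u dx_i),          *)
(*   Z = a^2 c (dz - sum_i y_i dx_i),  a = exp ((q - p) / 2),  c = exp (- q).    *)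
(* The forms dp /\ Z - sum_i X_i /\ Y_i = - dZ and dq /\ U = - dU are closed,    *)
(* so both - dZ + dq /\ U and - dZ - dq /\ U are symplectic forms compatible     *)
(* with g.  The first one is the Kaehler form of the symmetric space; the        *)
(* almost complex structure J of the second one is not integrable as soon as     *)
(* m > 0: if w is J-holomorphic, the commutators of the (0,1) fields Q - i U     *)
(* and X_i - i Y_i force X_i w = 0.                                              *)
(* In a frame with constant structure functions the curvature is constant.  In   *)
(* a Riemannian product it commutes with the projections on the factors; here    *)
(* the curvature operators R(P, -) and R(Q, -) give back all the connection      *)
(* matrices, and the only idempotents commuting with these are 0 and 1.          *)
(* For completeness, a proper function psi >= 1 satisfies |d psi| <= C psi, so   *)
(* that ln psi is Lipschitz and metric balls are relatively compact.             *)

(** * Smooth functions on open sets *)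

(** The reversed structure keeps [g], so Einstein, completeness and irreducibility are properties of
    the symmetric space; they are derived here from the group structure alone. Reversing the plane
    of [Q] and [U] preserves compatibility with [g], and the new fundamental form is exact: it is
    d(U - Z) ([closed_fundamental]). Local geometry reduces to the constants [nabla]. A coframe
    satisfying [structure_eq] with skew matrices [B a] carries a torsion-free metric connection, and
    such a connection is unique ([christoffelE]); so the coordinate curvature is conjugate to
    combinations of the constant matrices [frame_curv] ([curvatureE]). The Einstein equation becomes
    a finite trace ([ricciE], [einstein_alg]). For irreducibility, the structure equations survive
    pull-back to product coordinates ([pullback_structure]). There the projection on a factor,
    rewritten in the frame, is an idempotent commuting with every [frame_curv], hence with every
    connection matrix ([curv_parallel]). The commutant of the latter is a copy of the complex
    numbers, generated by the Kaehler structure, whose only idempotents are 0 and 1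
    ([commutant_idempotent]). For non-integrability, write i for sqrt(-1). If w is J-holomorphic
    then Q - iU and X - iY kill w, hence so does their commutator -(X + 3iY)/2; since Xw = iYw, this
    says 4 Xw = 0. Complex coordinates would then have differentials that all vanish on X
    ([acs_not_integrable]). For completeness, [psi_gradient] makes ln psi Lipschitz along paths
    ([model_path_increment]) and [psi_coord_bound] makes its sublevel sets relatively compact, so a
    Cauchy sequence has a cluster point ([complete_criterion]). *)

Section Partial.
Context {R : realType}.

Lemma partialE d (W : normedModType R) (j : 'I_d) (f : 'rV[R]_d -> W) x :
  differentiable f x -> partial j f x = 'd f x (delta_mx 0 j).
Proof. by move=> df; rewrite /partial deriveE. Qed.

Lemma near_eq_diff (V W : normedModType R) (f g : V -> W) x :
  (\forall y \near x, f y = g y) -> differentiable f x ->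
  differentiable g x /\ 'd g x = 'd f x :> (V -> W).
Proof.
move=> fg df.
have fgx : f x = g x by exact: nbhs_singleton fg.
have H : g \o shift x = cst (g x) + 'd f x +o_ 0 id.
  apply/eqaddoP => e e0.
  have /eqaddoP/(_ e e0) := diff_locally df.
  have fg0 : \forall y \near 0, f (y + x) = g (y + x).
    by move: fg; rewrite (near_shift 0 x); apply: filterS => y /=; rewrite subr0.
  apply: filterS2 fg0 => y /= fgy.
  by rewrite !fctE /= fgy fgx.
have dE : 'd g x = 'd f x :> (V -> W).
  by apply: diff_unique H; exact: diff_continuous.
split=> //; apply/diff_locallyP; rewrite dE; split=> //.
exact: diff_continuous.
Qed.

Lemma near_eq_partial d (W : normedModType R) (j : 'I_d) (f g : 'rV[R]_d -> W) x :
  (\forall y \near x, f y = g y) -> partial j f x = partial j g x.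
Proof.
move=> fg; have fgx : f x = g x by exact: nbhs_singleton fg.
rewrite /partial /derive; congr (lim _).
have N : \forall h \near (0 : R)^',
    h^-1 *: ((f \o shift x) (h *: delta_mx 0 j) - f x) =
    h^-1 *: ((g \o shift x) (h *: delta_mx 0 j) - g x).
  have : (fun h : R => h *: (delta_mx 0 j : 'rV[R]_d) + x) @ (0 : R)^' -->
      (0 : R) *: (delta_mx 0 j : 'rV[R]_d) + x.
    apply: cvg_within_filter.
    by apply: cvgD; [exact: scalel_continuous|exact: cvg_cst].
  rewrite scale0r add0r => H; near=> h.
  have /= fgh : f (h *: delta_mx 0 j + x) = g (h *: delta_mx 0 j + x).
    by near: h; exact: (H _ fg).
  by rewrite /= fgh fgx.
apply/seteqP; split; apply: near_eq_cvg => //.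
by near=> h; apply/esym; near: h.
Unshelve. all: by end_near. Qed.

Section Open.
Variables (d : nat) (U : set 'rV[R]_d).
Hypothesis oU : open U.

Lemma open_eq_near T (f g : 'rV[R]_d -> T) x : U x -> {in U, f =1 g} ->
  \forall y \near x, f y = g y.
Proof.
move=> Ux fg; have : nbhs x U by exact: open_nbhs_nbhs.
by apply: filterS => y Uy; apply: fg; rewrite inE.
Qed.

(** Lets an identity that holds only on an open set be differentiated there. *)
Lemma eq_partial (W : normedModType R) j (f g : 'rV[R]_d -> W) :
  {in U, f =1 g} -> {in U, partial j f =1 partial j g}.
Proof.
by move=> fg x; rewrite inE => Ux; apply: near_eq_partial; apply: open_eq_near.
Qed.

Lemma eq_differentiable (W : normedModType R) (f g : 'rV[R]_d -> W) :
  {in U, f =1 g} -> (forall x, U x -> differentiable f x) ->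
  forall x, U x -> differentiable g x.
Proof.
move=> fg df x Ux; apply: (near_eq_diff (f := f) _ _).1; last exact: df.
exact: open_eq_near.
Qed.

End Open.

Lemma smooth_on_partial d (W : normedModType R) (U : set 'rV[R]_d)
   (f : 'rV[R]_d -> W) j : smooth_on U f -> smooth_on U (partial j f).
Proof. by move=> sf s x Ux; rewrite -foldr_rcons; exact: sf. Qed.

Lemma smooth_on_diff d (W : normedModType R) (U : set 'rV[R]_d)
   (f : 'rV[R]_d -> W) x : smooth_on U f -> U x -> differentiable f x.
Proof. by move=> sf Ux; exact: (sf [::]). Qed.

Lemma partial_coord d (j i : 'I_d) (x : 'rV[R]_d) :
  partial j (fun x : 'rV[R]_d => x 0 i : R) x = (i == j)%:R.
Proof.
rewrite /partial.
have := @derive_mx R 'rV[R]_d 1 d id x (delta_mx 0 j) (@derivable_id _ _ _ _).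
move=> /matrixP/(_ 0 i); rewrite mxE => <-.
by rewrite derive_id mxE eqxx.
Qed.

(** Recursion on the order rather than on a list of directions, so that the product and chain rules
    go through by induction; [k] is the highest order of the partials required to be
    differentiable. *)
Fixpoint Ck d (W : normedModType R) (k : nat) (U : set 'rV[R]_d)
    (f : 'rV[R]_d -> W) : Prop :=
  (forall x, U x -> differentiable f x) /\
  if k is k'.+1 then forall j, Ck k' U (partial j f) else True.

Lemma Ck_diff d (W : normedModType R) k (U : set 'rV[R]_d) (f : 'rV[R]_d -> W) :
  Ck k U f -> forall x, U x -> differentiable f x.
Proof. by case: k => [|k] []. Qed.

Lemma smooth_onP d (W : normedModType R) (U : set 'rV[R]_d)
    (f : 'rV[R]_d -> W) : smooth_on U f <-> forall k, Ck k U f.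
Proof.
split=> [sf k|Cf s].
  elim: k f sf => [|k IH] f sf; split=> //; try by move=> x; exact: smooth_on_diff.
  by move=> j; apply: IH; exact: smooth_on_partial.
(* [foldr] differentiates first along the last direction of the list, hence an induction from the
   right end. *)
elim/last_ind: s f Cf => [|s j IH] f Cf x Ux; first exact: (Ck_diff (Cf 0%N)).
by rewrite foldr_rcons; apply: IH => // k; exact: (Cf k.+1).2.
Qed.

Lemma CkW d (W : normedModType R) k (U : set 'rV[R]_d) (f : 'rV[R]_d -> W) :
  Ck k.+1 U f -> Ck k U f.
Proof.
elim: k f => [|k IH] f [df Cf]; split=> // j; apply: IH; exact: Cf.
Qed.

Lemma Ck_subset d (W : normedModType R) k (U V : set 'rV[R]_d)
    (f : 'rV[R]_d -> W) : U `<=` V -> Ck k V f -> Ck k U f.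
Proof.
move=> UV; elim: k f => [|k IH] f [df Cf]; split=> //;
  try by move=> x Ux; exact: (df x (UV x Ux)).
by move=> j; apply: IH; exact: (Cf j).
Qed.

Section CkOpen.
Variables (d : nat) (U : set 'rV[R]_d).
Hypothesis oU : open U.

Lemma eq_Ck (W : normedModType R) k (f g : 'rV[R]_d -> W) :
  {in U, f =1 g} -> Ck k U f -> Ck k U g.
Proof.
elim: k f g => [|k IH] f g fg [df Cf]; split=> //.
- exact: eq_differentiable df.
- exact: eq_differentiable df.
- by move=> j; apply: IH (Cf j); exact: eq_partial.
Qed.

Lemma Ck_cst (W : normedModType R) k (c : W) : Ck k U (fun _ : 'rV[R]_d => c).
Proof.
elim: k c => [|k IH] c; split=> // j.
rewrite (_ : partial j _ = fun=> 0); first exact: IH.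
by apply/funext => x; rewrite /partial derive_cst.
Qed.

Lemma CkD (W : normedModType R) k (f g : 'rV[R]_d -> W) :
  Ck k U f -> Ck k U g -> Ck k U (fun x => f x + g x).
Proof.
elim: k f g => [|k IH] f g [df Cf] [dg Cg]; split=> //;
  try by move=> x Ux; apply: differentiableD; [exact: df|exact: dg].
move=> j; apply: eq_Ck (IH _ _ (Cf j) (Cg j)) => x; rewrite inE => Ux.
by rewrite /partial deriveD //; apply: diff_derivable; [exact: df|exact: dg].
Qed.

Lemma CkM k (f g : 'rV[R]_d -> R) :
  Ck k U f -> Ck k U g -> Ck k U (fun x => f x * g x).
Proof.
elim: k f g => [|k IH] f g Cf Cg.
  by split=> // x Ux; apply: differentiableM; [exact: Cf.1|exact: Cg.1].
have [df Cf'] := Cf; have [dg Cg'] := Cg; split=> [x Ux|j].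
  by apply: differentiableM; [exact: df|exact: dg].
apply: eq_Ck (CkD (IH _ _ (CkW Cf) (Cg' j)) (IH _ _ (CkW Cg) (Cf' j))) => x.
rewrite inE => Ux.
by rewrite /partial deriveM //; apply: diff_derivable; [exact: df|exact: dg].
Qed.

Lemma Ck_sum (W : normedModType R) (I : Type) (s : seq I) k
    (f : I -> 'rV[R]_d -> W) :
  (forall i, Ck k U (f i)) -> Ck k U (fun x => \sum_(i <- s) f i x).
Proof.
move=> Cf; elim: s => [|i s IH].
  by under eq_fun do rewrite big_nil; exact: Ck_cst.
by under eq_fun do rewrite big_cons; exact: CkD.
Qed.

Lemma Ck_coord k (i : 'I_d) : Ck k U (fun x : 'rV[R]_d => x 0 i : R).
Proof.
case: k => [|k]; split=> //; try by move=> x Ux; exact: differentiable_coord.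
move=> j; rewrite (_ : partial j _ = fun=> ((i == j)%:R : R)); first exact: Ck_cst.
by apply/funext => x; exact: partial_coord.
Qed.

End CkOpen.

End Partial.

(** * Matrix-valued functions, chain rule and symmetry of second partials *)

Lemma mulmx_coef (R : pzSemiRingType) m n p (P : 'M[R]_(m, n)) (Q : 'M[R]_(n, p)) i j :
  (P *m Q) i j = \sum_k P i k * Q k j.
Proof. exact: mxE. Qed.

Section Coordinates.
Context {R : realType}.

Lemma differentiable_mxP (V : normedModType R) m n (F : V -> 'M[R]_(m, n)) x :
  differentiable F x <-> forall i j, differentiable (fun y => F y i j : R) x.
Proof.
split=> [dF i j|dF].
  exact: (differentiable_comp dF (differentiable_coord _ i j)).
have -> : F = \sum_(i < m) \sum_(j < n) (fun y => (F y i j : R) *: delta_mx i j).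
  apply/funext => y; rewrite fct_sumE {1}(matrix_sum_delta (F y)).
  by apply: eq_bigr => i _; rewrite fct_sumE.
do 2 (apply: differentiable_sum => ?); exact: differentiableZl.
Qed.

Lemma partial_mx d m n (j : 'I_d) (F : 'rV[R]_d -> 'M[R]_(m, n)) x :
  differentiable F x ->
  partial j F x = \matrix_(a, b) partial j (fun y => F y a b : R) x.
Proof. by move=> dF; rewrite /partial derive_mx //; exact: diff_derivable. Qed.

Lemma jacobianE d m (f : 'rV[R]_d -> 'rV[R]_m) x i j : differentiable f x ->
  'J f x i j = partial i (fun y => f y 0 j : R) x.
Proof.
move=> df; have := partial_mx i df; rewrite /partial deriveEjacobian //.
by move=> /matrixP/(_ 0 j); rewrite -rowE !mxE.
Qed.

Lemma partial_comp d m (f : 'rV[R]_d -> 'rV[R]_m) (w : 'rV[R]_m -> R) j x :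
  differentiable f x -> differentiable w (f x) ->
  partial j (fun y => w (f y)) x =
  \sum_(i < m) partial j (fun y => f y 0 i : R) x * partial i w (f x).
Proof.
move=> df dw; rewrite partialE; last exact: (differentiable_comp df dw).
rewrite (diff_comp df dw) /= -partialE // [X in 'd w _ X]row_sum_delta.
rewrite linear_sum; apply: eq_bigr => i _; rewrite linearZ /= -partialE //.
by rewrite partial_mx // mxE.
Qed.

Section CkOpen.
Variables (d : nat) (U : set 'rV[R]_d).
Hypothesis oU : open U.

Lemma Ck_mxP m n k (F : 'rV[R]_d -> 'M[R]_(m, n)) :
  Ck k U F <-> forall i j, Ck k U (fun y => F y i j : R).
Proof.
elim: k F => [|k IH] F.
  split=> [[dF _] i j|dF]; split=> // x Ux; first exact: ((differentiable_mxP F x).1 (dF _ Ux) i j).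
  by apply/differentiable_mxP => i j; exact: (dF i j).1.
split=> [[dF CF] i j|CF].
  split=> [x Ux|l]; first exact: ((differentiable_mxP F x).1 (dF _ Ux) i j).
  apply: eq_Ck ((IH _).1 (CF l) i j) => // x; rewrite inE => Ux.
  by rewrite partial_mx ?mxE //; exact: dF.
have dF x : U x -> differentiable F x.
  by move=> Ux; apply/differentiable_mxP => i j; exact: (CF i j).1.
split=> // l; apply/IH => i j; apply: eq_Ck ((CF i j).2 l) => // x.
by rewrite inE => Ux; rewrite partial_mx ?mxE //; exact: dF.
Qed.

Lemma Ck_mulmx m n p k (F : 'rV[R]_d -> 'M[R]_(m, n)) (G : 'rV[R]_d -> 'M[R]_(n, p)) :
  Ck k U F -> Ck k U G -> Ck k U (fun y => F y *m G y).
Proof.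
move=> /Ck_mxP CF /Ck_mxP CG; apply/Ck_mxP => i j.
under eq_fun do rewrite mulmx_coef.
by apply: Ck_sum => // l; apply: CkM.
Qed.

Lemma Ck_trmx m n k (F : 'rV[R]_d -> 'M[R]_(m, n)) :
  Ck k U F -> Ck k U (fun y => (F y)^T).
Proof.
move=> /Ck_mxP CF; apply/Ck_mxP => i j.
by under eq_fun do rewrite mxE.
Qed.

Lemma Ck_comp m (V : set 'rV[R]_m) k (f : 'rV[R]_d -> 'rV[R]_m)
    (w : 'rV[R]_m -> R) :
  (forall x, U x -> V (f x)) -> Ck k U f -> Ck k V w ->
  Ck k U (fun x => w (f x)).
Proof.
move=> UV; elim: k w => [|k IH] w Cf Cw.
  split=> // x Ux.
  by apply: (differentiable_comp (Cf.1 _ Ux)); apply: Cw.1; exact: UV.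
split=> [x Ux|j].
  by apply: (differentiable_comp (Cf.1 _ Ux)); apply: Cw.1; exact: UV.
have Cf' i : Ck k U (partial j (fun y => f y 0 i : R)).
  by have /Ck_mxP/(_ 0 i) := Cf; case=> _; apply.
have := @Ck_sum R d U oU _ 'I_m (index_enum 'I_m) k
  (fun i x => partial j (fun y => f y 0 i : R) x * partial i w (f x)).
move=> H; apply: eq_Ck (H _) => // [x|i].
  rewrite inE => Ux; rewrite partial_comp //; first exact: Cf.1.
  by apply: Cw.1; exact: UV.
by apply: CkM => //; apply: IH; [exact: CkW|exact: Cw.2].
Qed.

Lemma partial_expR (f : 'rV[R]_d -> R) j x : differentiable f x ->
  partial j (fun y => expR (f y)) x = expR (f x) * partial j f x.
Proof.
move=> df.
have de : differentiable (@expR R) (f x) by exact/derivable1_diffP/derivable_expR.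
rewrite partialE; last exact: (differentiable_comp df de).
rewrite (diff_comp df de) /= -partialE //.
have -> := deriv1E (@derivable_expR R (f x)).
by rewrite derive1E derive_val [LHS]mulrC.
Qed.

Lemma Ck_expR k (f : 'rV[R]_d -> R) :
  Ck k U f -> Ck k U (fun x => expR (f x)).
Proof.
have de y : differentiable (@expR R) y by exact/derivable1_diffP/derivable_expR.
elim: k f => [|k IH] f Cf.
  by split=> // x Ux; exact: (differentiable_comp (Cf.1 _ Ux)).
split=> [x Ux|j]; first exact: (differentiable_comp (Cf.1 _ Ux)).
apply: eq_Ck (CkM oU (IH _ (CkW Cf)) (Cf.2 j)) => // x.
by rewrite inE => Ux; rewrite partial_expR //; exact: Cf.1.
Qed.

End CkOpen.

Lemma is_derive_line (V W : normedModType R) (f : V -> W) y e (s : R) :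
  derivable f (y + s *: e) e ->
  is_derive s 1 (fun s : R => f (y + s *: e)) ('D_e f (y + s *: e)).
Proof.
move=> df.
have E : (fun h : R => h^-1 *: (((fun s : R => f (y + s *: e)) \o shift s) (h *: 1)
     - f (y + s *: e))) =
  (fun h : R => h^-1 *: ((f \o shift (y + s *: e)) (h *: e) - f (y + s *: e))).
  apply/funext => h /=; congr (_ *: (f _ - _)).
  by rewrite [h *: 1]mulr1 scalerDl addrCA.
by apply: DeriveDef; rewrite /derivable /derive E.
Qed.

Lemma norm_delta_le1 d (j : 'I_d) : `|delta_mx 0 j : 'rV[R]_d| <= 1.
Proof.
rewrite [leLHS]/Num.Def.normr/= mx_normrE bigmax_le // => -[a b] _ /=.
by rewrite mxE; case: (_ && _); rewrite ?normr1 ?normr0 ?ler01.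
Qed.

Section Schwarz.
Variables (d : nat) (U : set 'rV[R]_d) (f : 'rV[R]_d -> R).
Hypothesis (oU : open U).

(** The mean value theorem twice: along [i] for the difference of [f] on two parallel edges of the
    square, then along [j] for the resulting difference of first partials. *)
Lemma second_difference i j x (h : R) : Ck 2 U f -> 0 < h ->
  (forall a b : R, 0 <= a <= h -> 0 <= b <= h ->
     U (x + a *: delta_mx 0 i + b *: delta_mx 0 j)) ->
  exists a b : R, [/\ 0 <= a <= h, 0 <= b <= h &
    f (x + h *: delta_mx 0 i + h *: delta_mx 0 j) - f (x + h *: delta_mx 0 i)
    - f (x + h *: delta_mx 0 j) + f x =
    h * h * partial j (partial i f) (x + a *: delta_mx 0 i + b *: delta_mx 0 j)].
Proof.
move=> Cf h0 Ux; set ei := delta_mx 0 i; set ej := delta_mx 0 j.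
have df y : U y -> differentiable f y := Cf.1 y.
have df1 y : U y -> differentiable (partial i f) y := (Cf.2 i).1 y.
have hh : 0 <= h <= h by rewrite (ltW h0) lexx.
have h00 : 0 <= (0 : R) <= h by rewrite (ltW h0) lexx.
pose g (s : R) := f (x + h *: ej + s *: ei) - f (x + s *: ei).
have Ux1 a : 0 <= a <= h -> U (x + h *: ej + a *: ei).
  by move=> ha; rewrite addrAC; exact: Ux.
have Ux0 a : 0 <= a <= h -> U (x + a *: ei).
  by move=> ha; have := Ux a 0 ha h00; rewrite scale0r addr0.
have gd a : 0 <= a <= h -> is_derive a 1 g
    (partial i f (x + h *: ej + a *: ei) - partial i f (x + a *: ei)).
  move=> ha; apply: is_deriveB; apply: is_derive_line; apply: diff_derivable.
    exact/df/Ux1.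
  exact/df/Ux0.
have gc : {within `[0, h], continuous g}.
  apply: derivable_within_continuous => z; rewrite in_itv /= => zh.
  by have [] := gd z zh.
have [a] := MVT h0 (fun z (zh : z \in `]0, h[%R) =>
  gd z (ltac:(by move: zh; rewrite in_itv /= => /andP[/ltW -> /ltW ->]))) gc.
rewrite in_itv /= subr0 => /andP[/ltW a0 /ltW ah] gE.
have ha : 0 <= a <= h by rewrite a0.
pose k (t : R) := partial i f (x + a *: ei + t *: ej).
have kd b : 0 <= b <= h -> is_derive b 1 k
    (partial j (partial i f) (x + a *: ei + b *: ej)).
  move=> hb; apply: is_derive_line; apply: diff_derivable.
  exact/df1/Ux.
have kc : {within `[0, h], continuous k}.
  apply: derivable_within_continuous => z; rewrite in_itv /= => zh.
  by have [] := kd z zh.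
have [b] := MVT h0 (fun z (zh : z \in `]0, h[%R) =>
  kd z (ltac:(by move: zh; rewrite in_itv /= => /andP[/ltW -> /ltW ->]))) kc.
rewrite in_itv /= subr0 => /andP[/ltW b0 /ltW bh] kE.
exists a, b; split; rewrite ?a0 ?b0 //.
have := gE; rewrite /g scale0r !addr0 [x + h *: ej + _]addrAC => E1.
rewrite (_ : _ + f x = f (x + h *: ei + h *: ej) - f (x + h *: ei) - (f (x + h *: ej) - f x)); last by ring.
rewrite E1 -mulrA mulrC; congr (_ * _).
by move: kE; rewrite /k scale0r addr0 addrAC mulrC.
Qed.

(** The second difference over a small square is symmetric in the two directions, and equals the
    area times either mixed partial at nearby points; continuity of these partials concludes. *)
Lemma Schwarz i j x : Ck 2 U f -> U x ->
  partial j (partial i f) x = partial i (partial j f) x.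
Proof.
move=> Cf Ux; apply/eqP/negPn/negP => neq.
have C a b : {for x, continuous (partial a (partial b f))}.
  apply: differentiable_continuous; exact: ((Cf.2 b).2 a).1.
(* Half of the supposed gap: no number is within [e] of both mixed partials at [x]. *)
pose e := `|partial j (partial i f) x - partial i (partial j f) x| / 2.
have e0 : 0 < e by rewrite divr_gt0 // normr_gt0 subr_eq0.
have : nbhs x (U `&`
    ([set t | `|partial j (partial i f) x - partial j (partial i f) t| < e] `&`
     [set t | `|partial i (partial j f) x - partial i (partial j f) t| < e])).
  apply: filterI; first exact: open_nbhs_nbhs.
  by apply: filterI; [move/cvgrPdist_lt: (C j i)|move/cvgrPdist_lt: (C i j)]; apply.
move=> /nbhs_ballP[r /= r0 rU].
have [h h0 hr] : exists2 h : R, 0 < h & h + h < r.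
  exists (r / 4); first by rewrite divr_gt0.
  rewrite (_ : r / 4 + r / 4 = r / 2); last by field.
  by rewrite ltr_pdivrMr // ltr_pMr // ltr1n.
have B k l (a b : R) : 0 <= a <= h -> 0 <= b <= h ->
    ball x r (x + a *: delta_mx 0 k + b *: delta_mx 0 l).
  move=> /andP[a0 ah] /andP[b0 bh]; rewrite -ball_normE /= -addrA opprD addNKr -normrN opprK.
  apply: le_lt_trans (ler_normD _ _) _; rewrite !normrZ !ger0_norm //.
  have H1 (t : R) q : 0 <= t <= h -> t * `|delta_mx 0 q : 'rV[R]_d| <= h.
    move=> /andP[t0 th]; apply: le_trans (th).
    by rewrite -[leRHS]mulr1 ler_wpM2l // norm_delta_le1.
  have H2 : a * `|delta_mx 0 k : 'rV[R]_d| <= h by apply: H1; rewrite a0.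
  have H3 : b * `|delta_mx 0 l : 'rV[R]_d| <= h by apply: H1; rewrite b0.
  exact: le_lt_trans (lerD H2 H3) hr.
have UB k l (a b : R) ha hb := (rU _ (B k l a b ha hb)).1.
have [a [b [ha hb E1]]] := second_difference Cf h0 (UB i j).
have [a' [b' [ha' hb' E2]]] := second_difference Cf h0 (UB j i).
have E3 : partial j (partial i f) (x + a *: delta_mx 0 i + b *: delta_mx 0 j) =
  partial i (partial j f) (x + a' *: delta_mx 0 j + b' *: delta_mx 0 i).
  apply: (@mulfI _ (h * h)); first by rewrite mulf_neq0 // gt_eqF.
  apply: etrans (esym E1) _; apply: etrans _ E2.
  rewrite (_ : x + h *: delta_mx 0 j + h *: delta_mx 0 i =
               x + h *: delta_mx 0 i + h *: delta_mx 0 j); last exact: addrAC.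
  by congr (_ + f x); exact: addrAC.
have /= := (rU _ (B i j a b ha hb)).2.1; rewrite E3 => D1.
have /= D2 := (rU _ (B j i a' b' ha' hb')).2.2.
have := @ler_normB _ R (partial j (partial i f) x - partial i (partial j f)
           (x + a' *: delta_mx 0 j + b' *: delta_mx 0 i))
     (partial i (partial j f) x - partial i (partial j f)
           (x + a' *: delta_mx 0 j + b' *: delta_mx 0 i)).
rewrite opprB addrA subrK => D3.
have := le_lt_trans D3 (ltrD D1 D2).
by rewrite /e -splitr ltxx.
Qed.

End Schwarz.
End Coordinates.

(** * Levi-Civita connection of an orthonormal coframe *)

Section MatrixPartial.
Context {R : realType} {d : nat}.
Implicit Types (x : 'rV[R]_d).

Lemma differentiable_mulmx m n p (F : 'rV[R]_d -> 'M[R]_(m, n))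
    (G : 'rV[R]_d -> 'M[R]_(n, p)) x :
  differentiable F x -> differentiable G x ->
  differentiable (fun y => F y *m G y) x.
Proof.
move=> /differentiable_mxP dF /differentiable_mxP dG.
apply/differentiable_mxP => i j.
have -> : (fun y => (F y *m G y) i j : R) = \sum_k (fun y => F y i k * G y k j).
  by apply/funext => y; rewrite mxE fct_sumE.
by apply: differentiable_sum => k; apply: differentiableM.
Qed.

Lemma partial_mulmx m n p l (F : 'rV[R]_d -> 'M[R]_(m, n))
    (G : 'rV[R]_d -> 'M[R]_(n, p)) x :
  differentiable F x -> differentiable G x ->
  partial l (fun y => F y *m G y) x =
  partial l F x *m G x + F x *m partial l G x.
Proof.
move=> dF dG; have dFG := differentiable_mulmx dF dG.
rewrite !partial_mx //; apply/matrixP => i j; rewrite !mxE.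
move/differentiable_mxP: dF => dF; move/differentiable_mxP: dG => dG.
have -> : (fun y => (F y *m G y) i j : R) = \sum_k (fun y => F y i k * G y k j).
  by apply/funext => y; rewrite mxE fct_sumE.
rewrite /partial derive_sum => [|k]; last first.
  by apply: diff_derivable; apply: differentiableM.
rewrite -big_split; apply: eq_bigr => k _ /=.
rewrite deriveM; [|exact: diff_derivable..].
by rewrite !mxE addrC; congr (_ + _); rewrite [LHS]mulrC.
Qed.

Lemma partial_trmx m n l (F : 'rV[R]_d -> 'M[R]_(m, n)) x :
  differentiable F x -> partial l (fun y => (F y)^T) x = (partial l F x)^T.
Proof.
move=> dF; have dFT : differentiable (fun y => (F y)^T) x.
  apply/differentiable_mxP => i j; under eq_fun do rewrite mxE.
  by move/differentiable_mxP: dF.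
rewrite !partial_mx //; apply/matrixP => i j; rewrite !mxE.
by congr (partial l _ x); apply/funext => y; rewrite mxE.
Qed.

Lemma partialD (W : normedModType R) l (f g : 'rV[R]_d -> W) x :
  differentiable f x -> differentiable g x ->
  partial l (fun y => f y + g y) x = partial l f x + partial l g x.
Proof. by move=> df dg; rewrite /partial deriveD //; exact: diff_derivable. Qed.

Lemma differentiable_bigsum (W : normedModType R) n (f : 'I_n -> 'rV[R]_d -> W) x :
  (forall k, differentiable (f k) x) ->
  differentiable (fun y => \sum_k f k y) x.
Proof.
move=> df; rewrite (_ : (fun y => _) = \sum_k f k); first exact: differentiable_sum.
by apply/funext => y; rewrite fct_sumE.
Qed.

Lemma partial_sum (W : normedModType R) n l (f : 'I_n -> 'rV[R]_d -> W) x :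
  (forall k, differentiable (f k) x) ->
  partial l (fun y => \sum_k f k y) x = \sum_k partial l (f k) x.
Proof.
move=> df; rewrite (_ : (fun y => _) = \sum_k f k).
  by rewrite /partial derive_sum // => k; exact: diff_derivable.
by apply/funext => y; rewrite fct_sumE.
Qed.

Lemma partialZl (W : normedModType R) l (f : 'rV[R]_d -> R) (w : W) x :
  differentiable f x -> partial l (fun y => f y *: w) x = partial l f x *: w.
Proof.
move=> df; rewrite !partialE //; last exact: differentiableZl.
by rewrite diffZl.
Qed.

Lemma SchwarzM (U : set 'rV[R]_d) m n (F : 'rV[R]_d -> 'M[R]_(m, n)) i j x :
  open U -> Ck 2 U F -> U x ->
  partial j (partial i F) x = partial i (partial j F) x.
Proof.
move=> oU CF Ux.
have E k l a b : (partial k (partial l F) x) a b =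
    partial k (partial l (fun y => F y a b : R)) x.
  rewrite partial_mx ?mxE; last exact: (CF.2 l).1.
  apply: (eq_partial oU); last by rewrite inE.
  by move=> y; rewrite inE => Uy; rewrite partial_mx ?mxE //; exact: CF.1.
apply/matrixP => a b; apply: etrans (E j i a b) _; apply: etrans _ (esym (E i j a b)).
by apply: (Schwarz oU) => //; have /(Ck_mxP oU) := CF.
Qed.

End MatrixPartial.

(** * Connection and curvature in a moving frame *)

Section Frame.
Context {R : realType} {d m : nat}.
Variables (V : set 'rV[R]_d) (h : 'rV[R]_d -> 'M[R]_d).
Variables (th : 'rV[R]_d -> 'M[R]_(d, m)) (E : 'rV[R]_d -> 'M[R]_(m, d)).
Variable B : 'I_m -> 'M[R]_m.

(* Rows of [th x] are indexed by coordinates and columns by the coframe; row b of *)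
(* [B a] holds the components of nabla_(E_a) E_b, so that [E_a, E_b] has          *)
(* components B a b c - B b a c and this is Cartan's first structure equation.    *)
Definition structure_eq := forall x, V x -> forall i j c,
  partial i (fun y => th y j c : R) x - partial j (fun y => th y i c : R) x =
  \sum_a \sum_b th x i a * th x j b * (B b a c - B a b c).

(** Row c holds the components of R(E_a, E_b) E_c. The products appear in reverse order because
    matrices act on the right. *)
Definition frame_curv a b : 'M[R]_m :=
  \sum_c (B b a c - B a b c) *: B c + B b *m B a - B a *m B b.

Hypothesis oV : open V.
Hypothesis hE : forall x, V x -> h x = th x *m (th x)^T.
Hypothesis thE : forall x, V x -> th x *m E x = 1%:M.
Hypothesis Eth : forall x, V x -> E x *m th x = 1%:M.
Hypothesis BT : forall a, (B a)^T = - B a.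
Hypothesis Cth : Ck 2 V th.
Hypothesis CE : Ck 1 V E.
Hypothesis str : structure_eq.

Definition conn_form i x : 'M[R]_m := \sum_a th x i a *: B a.
Local Notation Bf := conn_form.
(** Row j is the covariant derivative of the coordinate field d/dx_j along d/dx_i, in the frame;
    [conn_coef] below expresses the same vector in coordinates, and so is the candidate for the
    Christoffel symbols. *)
Definition conn_cov i x : 'M[R]_(d, m) := th x *m Bf i x + partial i th x.
Local Notation D := conn_cov.
Definition conn_coef i x : 'M[R]_d := D i x *m E x.
Local Notation A := conn_coef.

Lemma diff_coframe x : V x -> differentiable th x.
Proof. exact: Cth.1. Qed.
Lemma diff_coframe_coef x a b : V x -> differentiable (fun y => th y a b : R) x.
Proof. by move=> Vx; have /differentiable_mxP := diff_coframe Vx. Qed.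
Lemma diff_frame x : V x -> differentiable E x.
Proof. exact: CE.1. Qed.
Lemma diff_conn_form i x : V x -> differentiable (Bf i) x.
Proof.
by move=> Vx; apply: differentiable_bigsum => k; apply: differentiableZl; exact: diff_coframe_coef.
Qed.
Lemma diff_partial_coframe i x : V x -> differentiable (partial i th) x.
Proof. exact: (Cth.2 i).1. Qed.
Lemma diff_conn_cov i x : V x -> differentiable (D i) x.
Proof.
move=> Vx; apply: differentiableD; last exact: diff_partial_coframe.
by apply: differentiable_mulmx; [exact: diff_coframe|exact: diff_conn_form].
Qed.
Lemma diff_conn_coef i x : V x -> differentiable (A i) x.
Proof. by move=> Vx; apply: differentiable_mulmx; [exact: diff_conn_cov|exact: diff_frame]. Qed.

Lemma conn_coef_coframe i x : V x -> A i x *m th x = D i x.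
Proof. by move=> Vx; rewrite /conn_coef -mulmxA Eth // mulmx1. Qed.

(** Vanishing of the torsion, which is the content of the first structure equation. *)
Lemma conn_cov_sym i j x c : V x -> D i x j c = D j x i c.
Proof.
move=> Vx; apply/eqP; rewrite -subr_eq0 /conn_cov; rewrite !partial_mx; [|exact: diff_coframe..].
rewrite !mxE.
have S k l : \sum_j0 th x k j0 * Bf l x j0 c =
    \sum_a \sum_b th x l a * th x k b * B a b c.
  rewrite exchange_big; apply: eq_bigr => b _ /=; rewrite /conn_form summxE mulr_sumr.
  by apply: eq_bigr => a _; rewrite mxE; ring.
rewrite !S opprD addrACA str // addrC [X in _ - X]exchange_big /= -sumrB -big_split /=.
apply/eqP/big1 => a _; rewrite -sumrB -big_split; apply: big1 => b _ /=; ring.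
Qed.

Lemma conn_coefC i j x k : V x -> A i x j k = A j x i k.
Proof.
move=> Vx; rewrite /conn_coef.
have := fun c => conn_cov_sym i j c Vx; move: (D i x) (D j x) => P Q PQ.
by rewrite !mulmx_coef; apply: eq_bigr => c _; rewrite PQ.
Qed.

Lemma differentiable_tr x : V x -> differentiable (fun y => (th y)^T) x.
Proof.
move=> Vx; apply/differentiable_mxP => a b; under eq_fun do rewrite mxE.
exact: diff_coframe_coef.
Qed.

Lemma metric_alg (t P : 'M[R]_(d, m)) (b : 'M[R]_m) : b^T = - b ->
  P *m t^T + t *m P^T = (t *m b + P) *m t^T + ((t *m b + P) *m t^T)^T.
Proof.
move=> bT; rewrite mulmxDl linearD /= !trmx_mul trmxK bT mulNmx mulmxN mulmxA.
by rewrite addrACA subrr add0r.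
Qed.

Lemma conn_form_tr l x : (Bf l x)^T = - Bf l x.
Proof.
rewrite /conn_form linear_sum -sumrN; apply: eq_bigr => a _ /=.
by rewrite linearZ /= BT scalerN.
Qed.

Lemma conn_coef_metric l x : V x -> A l x *m h x = D l x *m (th x)^T.
Proof. by move=> Vx; rewrite hE // mulmxA conn_coef_coframe. Qed.

(** Compatibility with the metric: the connection matrices are skew, so their contributions to the
    right-hand side cancel. *)
Lemma partial_metric l x : V x ->
  partial l h x = A l x *m h x + (A l x *m h x)^T.
Proof.
move=> Vx.
have Vx' : x \in V by rewrite inE.
have E1 : {in V, h =1 (fun y => th y *m (th y)^T)}.
  by move=> y; rewrite inE; exact: hE.
apply: etrans (eq_partial oV l E1 Vx') _.
apply: etrans (partial_mulmx l (diff_coframe Vx) (differentiable_tr Vx)) _.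
rewrite conn_coef_metric // /conn_cov.
apply: etrans (metric_alg _ _ (conn_form_tr l x)).
by congr (_ + _ *m _); apply: partial_trmx; exact: diff_coframe.
Qed.

Lemma invmx_metric x : V x -> invmx (h x) = (E x)^T *m E x.
Proof.
move=> Vx; have H : h x *m ((E x)^T *m E x) = 1%:M.
  by rewrite hE // mulmxA -(mulmxA (th x)) -trmx_mul Eth // trmx1 mulmx1 thE.
have [U _] := mulmx1_unit H.
by rewrite -[LHS]mulmx1 -H mulKmx.
Qed.

(** Koszul's computation: [S a b l] stands for the product of the covariant derivative of e_b along
    e_a with e_l, and its symmetry in a and b leaves two equal terms out of six. *)
Lemma christoffel_alg (S : 'I_d -> 'I_d -> 'I_d -> R) (iv : 'I_d -> R) i j :
  (forall a b l, S a b l = S b a l) ->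
  2^-1 * \sum_l iv l * (S i j l + S i l j + (S j i l + S j l i) - (S l i j + S l j i))
  = \sum_l iv l * S i j l.
Proof.
move=> Ssym.
under eq_bigr => l _.
  rewrite (Ssym l i j) (Ssym l j i) (Ssym j i l).
  rewrite (_ : _ + _ - _ = 2 * S i j l); last by ring.
  rewrite mulrCA; over.
by rewrite -mulr_sumr mulrA mulVf ?pnatr_eq0 // mul1r.
Qed.

Lemma partial_metric_coef l a b x : V x ->
  partial l (fun y => h y a b : R^o) x = (A l x *m h x) a b + (A l x *m h x) b a.
Proof.
move=> Vx.
have dhx : differentiable h x.
  apply: (@eq_differentiable _ _ V oV _ (fun y => th y *m (th y)^T)) Vx.
    by move=> y; rewrite inE => /hE.
  move=> y Vy; apply: differentiable_mulmx; first exact: diff_coframe.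
  exact: differentiable_tr.
have := partial_metric l Vx; rewrite partial_mx // => /matrixP/(_ a b).
by move: (A l x *m h x) => P; rewrite mxE => ->; rewrite mxE [X in _ + X]mxE.
Qed.

(** Uniqueness of the Levi-Civita connection: the derivatives of [h] are given by [partial_metric],
    and [conn_coefC] supplies the symmetry that Koszul's formula needs. *)
Lemma christoffelE k i j x : V x -> christoffel h k i j x = A i x j k.
Proof.
move=> Vx; rewrite /christoffel.
have Ssym a b l : (A a x *m h x) b l = (A b x *m h x) a l.
  have := fun p => conn_coefC a b p Vx; move: (A a x) (A b x) => P Q PQ.
  by rewrite !mulmx_coef; apply: eq_bigr => c _; rewrite PQ.
have := christoffel_alg (invmx (h x) k) i j Ssym.
have pE := fun l a b => partial_metric_coef l a b Vx.
under eq_bigr do rewrite -!pE.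
move=> ->.
rewrite invmx_metric //; have := conn_coef_metric i Vx; rewrite /conn_coef.
move: (D i x) => P ->.
have -> : P *m E x = P *m (th x)^T *m ((E x)^T *m E x)^T.
  rewrite trmx_mul trmxK -mulmxA (mulmxA (th x)^T) -trmx_mul.
  by rewrite Eth // trmx1 mul1mx.
move: (P *m (th x)^T) ((E x)^T *m E x) => M N.
by rewrite mulmx_coef; apply: eq_bigr => l _; rewrite mxE mulrC.
Qed.

Definition curv_form i j x : 'M[R]_m :=
  \sum_a \sum_b (th x i a * th x j b) *: frame_curv a b.

Definition conn_curv i j x : 'M[R]_d :=
  partial i (A j) x - partial j (A i) x + A j x *m A i x - A i x *m A j x.

Local Notation F := conn_curv.

Lemma partial_conn_coef i j x : V x -> partial i (A j) x *m th x =
   partial i th x *m Bf j x + th x *m partial i (Bf j) x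
   + partial i (partial j th) x - A j x *m partial i th x.
Proof.
move=> Vx; apply/eqP; rewrite eq_sym subr_eq; apply/eqP.
apply: etrans _ (partial_mulmx i (diff_conn_coef j Vx) (diff_coframe Vx)).
have E1 : {in V, D j =1 (fun y => A j y *m th y)}.
  by move=> y; rewrite inE => Vy; rewrite conn_coef_coframe.
have Vx' : x \in V by rewrite inE.
apply: etrans _ (eq_partial oV i E1 Vx').
have dtb : differentiable (fun y => th y *m Bf j y) x.
  by apply: differentiable_mulmx; [exact: diff_coframe|exact: diff_conn_form].
apply: etrans _ (esym (partialD i dtb (diff_partial_coframe j Vx))).
by congr (_ + _); exact: esym (partial_mulmx i (diff_coframe Vx) (diff_conn_form j Vx)).
Qed.

Lemma partial_conn_form i j x : V x -> partial i (Bf j) x =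
  \sum_c partial i (fun y => th y j c : R) x *: B c.
Proof.
move=> Vx; rewrite /conn_form partial_sum => [|c].
  by apply: eq_bigr => c _; rewrite partialZl //; exact: diff_coframe_coef.
by apply: differentiableZl; exact: diff_coframe_coef.
Qed.

Lemma frame_curvE i j x : V x ->
  partial i (Bf j) x - partial j (Bf i) x + Bf j x *m Bf i x - Bf i x *m Bf j x =
  curv_form i j x.
Proof.
move=> Vx; rewrite !partial_conn_form // -sumrB.
have := str Vx i j.
move: (fun c => partial i (fun y => th y j c : R) x) => P.
move: (fun c => partial j (fun y => th y i c : R) x) => Q PQ.
under eq_bigr do rewrite -scalerBl PQ.
rewrite /conn_form /curv_form; move: (th x) => t.
have Bm k l : (\sum_a t k a *: B a) *m (\sum_a t l a *: B a) =
    \sum_a \sum_b (t l a * t k b) *: (B b *m B a).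
  rewrite mulmx_suml exchange_big; apply: eq_bigr => b _ /=.
  rewrite mulmx_sumr; apply: eq_bigr => a _ /=.
  by rewrite -scalemxAl -scalemxAr scalerA [X in X *: _]mulrC.
rewrite !Bm [X in _ - X]exchange_big.
have -> : \sum_i0 (\sum_a \sum_b t i a * t j b * (B b a i0 - B a b i0)) *: B i0 =
   \sum_a \sum_b (t i a * t j b) *: \sum_c (B b a c - B a b c) *: B c.
  under eq_bigr do rewrite scaler_suml.
  rewrite exchange_big; apply: eq_bigr => a _ /=.
  under eq_bigr do rewrite scaler_suml.
  rewrite exchange_big; apply: eq_bigr => b _ /=.
  by rewrite scaler_sumr; apply: eq_bigr => c _; rewrite scalerA.
rewrite -big_split -sumrB /=; apply: eq_bigr => a _.
rewrite -big_split -sumrB /=; apply: eq_bigr => b _.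
by rewrite /frame_curv scalerBr scalerDr [X in _ - X *: _]mulrC.
Qed.

(** Change of gauge by [t]: the first derivatives [ti], [tj] cancel, and so do the second
    derivatives, which are one and the same [S] by [SchwarzM]. What remains is conjugation of the
    curvature. *)
Lemma curv_alg (t ti tj S : 'M[R]_(d, m)) (bi bj bij bji : 'M[R]_m)
    (Ai Aj Aij Aji : 'M[R]_d) :
  Ai *m t = t *m bi + ti -> Aj *m t = t *m bj + tj ->
  Aij *m t = ti *m bj + t *m bij + S - Aj *m ti ->
  Aji *m t = tj *m bi + t *m bji + S - Ai *m tj ->
  (Aij - Aji + Aj *m Ai - Ai *m Aj) *m t = t *m (bij - bji + bj *m bi - bi *m bj).
Proof.
move=> Hi Hj Hij Hji.
rewrite mulmxBl mulmxDl mulmxBl Hij Hji -!mulmxA Hi Hj !mulmxDr !mulmxA Hi Hj.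
rewrite !mulmxDl !mulmxN !mulmxA.
move: (ti *m bj) (tj *m bi) (t *m bij) (t *m bji) (Aj *m ti) (Ai *m tj).
move: (t *m bj *m bi) (t *m bi *m bj) => {Hi Hj Hij Hji} *.
by apply/matrixP => q r; rewrite !mxE; ring.
Qed.

Lemma conn_curvE i j x : V x -> F i j x *m th x = th x *m curv_form i j x.
Proof.
move=> Vx; rewrite -frame_curvE //.
apply: (@curv_alg _ (partial i th x) (partial j th x) (partial i (partial j th) x)).
- exact: conn_coef_coframe.
- exact: conn_coef_coframe.
- exact: partial_conn_coef.
- exact: (etrans (partial_conn_coef j i Vx)
    (congr1 (fun S => partial j th x *m Bf i x + th x *m partial j (Bf i) x
       + S - A i x *m partial j th x) (SchwarzM i j oV Cth Vx))).
Qed.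

Lemma curvatureE l k i j x : V x ->
  curvature h l k i j x = (th x *m curv_form i j x *m E x) k l.
Proof.
move=> Vx; rewrite -conn_curvE // -mulmxA thE // mulmx1 /conn_curv /curvature.
have Vx' : x \in V by rewrite inE.
have pA a b c : partial a (christoffel h c b k) x = (partial a (A b) x) k c.
  rewrite partial_mx; last exact: diff_conn_coef.
  rewrite mxE; apply: (eq_partial oV) => // y; rewrite inE => Vy.
  exact: christoffelE.
rewrite !pA; move: (partial i (A j) x) (partial j (A i) x) => P Q.
have cE := fun a b c => christoffelE a b c Vx.
under eq_bigr do rewrite !cE.
move: (A i x) (A j x) => M N.
rewrite !mxE -addrA; congr (_ + _).
rewrite -sumrB; apply: eq_bigr => p _.
by rewrite mulrC [X in _ - X]mulrC.
Qed.

(** Ricci is a trace, so it may be taken in the frame, where the curvature is constant. *)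
Lemma ricciE (lambda : R) x :
  (forall b c, \sum_a frame_curv a b c a = lambda * (b == c)%:R) -> V x ->
  ricci h x = lambda *: h x.
Proof.
move=> HR Vx; apply/matrixP => j k; rewrite !mxE hE //.
under eq_bigr do rewrite curvatureE //.
rewrite /curv_form.
have : E x *m th x = 1%:M by exact: Eth.
move: (th x) (E x) => t e et.
have -> : \sum_i (t *m (\sum_a \sum_b (t i a * t j b) *: frame_curv a b) *m e) k i =
   \sum_a \sum_b t j b * \sum_i (t i a * (t *m frame_curv a b *m e) k i).
  under eq_bigr => i _.
    rewrite mulmx_sumr mulmx_suml summxE.
    under eq_bigr => a _.
      rewrite mulmx_sumr mulmx_suml summxE.
      under eq_bigr => b _.
        rewrite -scalemxAr -scalemxAl mxE mulrC.
      over.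
    over.
  over.
  rewrite exchange_big; apply: eq_bigr => a _; rewrite exchange_big.
  apply: eq_bigr => b _; rewrite mulr_sumr; apply: eq_bigr => i _ /=; ring.
have tr a b : \sum_i t i a * (t *m frame_curv a b *m e) k i =
    \sum_c t k c * frame_curv a b c a.
  transitivity ((t *m frame_curv a b *m e *m t) k a).
    by rewrite [RHS]mulmx_coef; apply: eq_bigr => i _; rewrite mulrC.
  by rewrite -mulmxA et mulmx1 mulmx_coef.
under eq_bigr => a _ do under eq_bigr => b _ do rewrite tr.
rewrite exchange_big mulmx_coef mulr_sumr; apply: eq_bigr => b _ /=.
rewrite -mulr_sumr mulrCA; congr (_ * _).
rewrite exchange_big /=; under eq_bigr do rewrite -mulr_sumr HR.
rewrite (bigD1 b) //= big1 ?addr0 => [|c cb]; first by rewrite eqxx mxE mulr1 mulrC.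
by rewrite eq_sym (negbTE cb) !mulr0.
Qed.

End Frame.

(** * The solvable Lie algebra *)

(* Names of the coordinates and of the dual frame vectors. *)
Inductive idx (m : nat) := iP | iQ | iU | iZ | iX of 'I_m | iY of 'I_m.
Arguments iP {m}.
Arguments iQ {m}.
Arguments iU {m}.
Arguments iZ {m}.

Section Index.
Variable m : nat.

(** The second component numbers the m + 2 planes P-Z, Q-U and X_i-Y_i, which J preserves; the
    Boolean tells the two directions of a plane apart. *)
Definition idx_code (a : idx m) : bool * option (option 'I_m) :=
  match a with
  | iP => (false, None) | iZ => (true, None)
  | iQ => (false, Some None) | iU => (true, Some None)
  | iX i => (false, Some (Some i)) | iY i => (true, Some (Some i))
  end.

Definition idx_decode (c : bool * option (option 'I_m)) : idx m :=
  match c with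
  | (false, None) => iP | (true, None) => iZ
  | (false, Some None) => iQ | (true, Some None) => iU
  | (false, Some (Some i)) => iX i | (true, Some (Some i)) => iY i
  end.

Lemma idx_codeK : cancel idx_code idx_decode.
Proof. by case. Qed.

Lemma idx_decodeK : cancel idx_decode idx_code.
Proof. by case=> -[] [[]|]. Qed.

HB.instance Definition _ := Finite.copy (idx m) (can_type idx_codeK).

Lemma card_idx : #|{: idx m}| = (2 * m.+2)%N.
Proof.
rewrite (bij_eq_card (f := idx_code)); last by exists idx_decode; [exact: idx_codeK|exact: idx_decodeK].
by rewrite card_prod card_bool !card_option card_ord.
Qed.

Definition ord_of_idx (a : idx m) : 'I_(2 * m.+2) := cast_ord card_idx (enum_rank a).
Definition idx_of_ord (i : 'I_(2 * m.+2)) : idx m := enum_val (cast_ord (esym card_idx) i).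

Lemma ord_of_idxK : cancel ord_of_idx idx_of_ord.
Proof. by move=> a; rewrite /ord_of_idx /idx_of_ord cast_ordK enum_rankK. Qed.

Lemma idx_of_ordK : cancel idx_of_ord ord_of_idx.
Proof. by move=> i; rewrite /ord_of_idx /idx_of_ord enum_valK cast_ordKV. Qed.

Lemma big_idx (V : nmodType) (F : idx m -> V) :
  \sum_a F a = F iP + F iQ + F iU + F iZ + \sum_i F (iX i) + \sum_i F (iY i).
Proof.
rewrite (reindex idx_decode) /=; last first.
  by apply: onW_bij; exists idx_code; [exact: idx_decodeK|exact: idx_codeK].
have -> : \sum_j F (idx_decode j) = \sum_b \sum_o F (idx_decode (b, o)).
  by rewrite pair_bigA; apply: eq_bigr => -[].
rewrite big_bool /=.
have bo (T : finType) (G : option T -> V) : \sum_o G o = G None + \sum_i G (Some i).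
  rewrite (bigD1 None) //=; congr (_ + _).
  by rewrite (reindex_omap Some id) /= => [|[]//]; apply: eq_bigl => i; rewrite eqxx.
by rewrite !bo /= !addrA [LHS](ACl (4*5*2*1*6*3)).
Qed.

Lemma big_ord_idx (V : nmodType) (F : 'I_(2 * m.+2) -> V) :
  \sum_i F i = \sum_a F (ord_of_idx a).
Proof.
apply: reindex; apply: onW_bij.
by exists idx_of_ord; [exact: ord_of_idxK|exact: idx_of_ordK].
Qed.

End Index.

(** * Algebra of the constant connection and of its curvature *)

Section LeviCivita.
Context {R : realType} {m : nat}.
Implicit Types (a b c : idx m) (v : idx m -> R).

(** Kronecker's delta, by cases so that it simplifies on constructors. *)
Definition dl a b : R :=
  match a, b with
  | iP, iP => 1 | iQ, iQ => 1 | iU, iU => 1 | iZ, iZ => 1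
  | iX i, iX j => (i == j)%:R
  | iY i, iY j => (i == j)%:R
  | _, _ => 0
  end.

Lemma dlE a b : dl a b = (a == b)%:R.
Proof.
by case: a b => [||||i|i] [||||j|j] //=.
Qed.

Lemma dlC a b : dl a b = dl b a.
Proof. by rewrite !dlE eq_sym. Qed.

Lemma sum_dl a v : \sum_c dl a c * v c = v a.
Proof.
rewrite (bigD1 a) //= big1 ?addr0 ?dlE ?eqxx ?mul1r // => c ca.
by rewrite dlE eq_sym (negbTE ca) mul0r.
Qed.

(* The value of the linear form v on nabla_(E_a) E_b, from Koszul's formula and the *)
(* brackets [P,Z] = Z, [Q,U] = U, [P,X] = X/2, [Q,X] = -X/2, [P,Y] = [Q,Y] = Y/2,   *)
(* [U,X_i] = Y_i, [X_i,Y_i] = -Z.                                                   *)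
Definition nabla a b v : R :=
  match a, b with
  | iZ, iP => - v iZ
  | iZ, iZ => v iP
  | iZ, iX i => 2^-1 * v (iY i)
  | iZ, iY i => - (2^-1 * v (iX i))
  | iU, iQ => - v iU
  | iU, iU => v iQ
  | iU, iX i => 2^-1 * v (iY i)
  | iU, iY i => - (2^-1 * v (iX i))
  | iX i, iP => - (2^-1 * v (iX i))
  | iX i, iQ => 2^-1 * v (iX i)
  | iX i, iU => - (2^-1 * v (iY i))
  | iX i, iZ => 2^-1 * v (iY i)
  | iX i, iX j => (i == j)%:R * (2^-1 * v iP - 2^-1 * v iQ)
  | iX i, iY j => (i == j)%:R * (2^-1 * v iU - 2^-1 * v iZ)
  | iY i, iP => - (2^-1 * v (iY i))
  | iY i, iQ => - (2^-1 * v (iY i))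
  | iY i, iU => - (2^-1 * v (iX i))
  | iY i, iZ => - (2^-1 * v (iX i))
  | iY i, iX j => (i == j)%:R * (2^-1 * v iU + 2^-1 * v iZ)
  | iY i, iY j => (i == j)%:R * (2^-1 * v iP + 2^-1 * v iQ)
  | _, _ => 0
  end.

(** [nabla] takes an arbitrary function [v]; linearity in [v] is what allows a matrix, [nabla_mx],
    to represent it. *)
Lemma nabla_is_linear a b : exists w : idx m -> R, forall v, nabla a b v = \sum_c w c * v c.
Proof.
have z : exists w : idx m -> R, forall v, 0 = \sum_c w c * v c.
  by exists (fun=> 0) => v; rewrite big1 // => c _; rewrite mul0r.
have s c : exists w : idx m -> R, forall v, v c = \sum_c w c * v c.
  by exists (dl c) => v; rewrite sum_dl.
have M (k : R) (f : (idx m -> R) -> R) : (exists w : idx m -> R, forall v, f v = \sum_c w c * v c) ->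
   exists w : idx m -> R, forall v, k * f v = \sum_c w c * v c.
  move=> [w wE]; exists (fun c => k * w c) => v; rewrite wE mulr_sumr.
  by apply: eq_bigr => c _; rewrite mulrA.
have N (f : (idx m -> R) -> R) : (exists w : idx m -> R, forall v, f v = \sum_c w c * v c) ->
   exists w : idx m -> R, forall v, - f v = \sum_c w c * v c.
  by move=> /(M (-1)) [w wE]; exists w => v; rewrite -wE mulN1r.
have A (f g : (idx m -> R) -> R) : (exists w : idx m -> R, forall v, f v = \sum_c w c * v c) ->
   (exists w : idx m -> R, forall v, g v = \sum_c w c * v c) ->
   exists w : idx m -> R, forall v, f v + g v = \sum_c w c * v c.
  move=> [w wE] [w' wE']; exists (fun c => w c + w' c) => v; rewrite wE wE' -big_split.
  by apply: eq_bigr => c _; rewrite mulrDl.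
case: a b => [||||i|i] [||||j|j] /=; do ?[exact: z | exact: s | apply: (N) | apply: (M) | apply: (A)].
Qed.

Lemma nabla_coef a b v : nabla a b v = \sum_c nabla a b (dl c) * v c.
Proof.
have [w wE] := nabla_is_linear a b.
rewrite wE; apply: eq_bigr => c _; congr (_ * _); rewrite wE.
rewrite (bigD1 c) //= big1 ?addr0 ?dlE ?eqxx ?mulr1 // => e ec.
by rewrite dlE eq_sym (negbTE ec) mulr0.
Qed.

Definition nabla_mx (a : 'I_(2 * m.+2)) : 'M[R]_(2 * m.+2) :=
  \matrix_(b, c) nabla (idx_of_ord a) (idx_of_ord b) (dl (idx_of_ord c)).

Lemma sum_nabla_mx a b (v : 'I_(2 * m.+2) -> R) :
  \sum_c nabla_mx (ord_of_idx a) (ord_of_idx b) c * v c =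
  nabla a b (fun c => v (ord_of_idx c)).
Proof.
rewrite nabla_coef big_ord_idx; apply: eq_bigr => c _.
by rewrite mxE !ord_of_idxK.
Qed.

Lemma nabla_mxE a b c : nabla_mx (ord_of_idx a) (ord_of_idx b) (ord_of_idx c) = nabla a b (dl c).
Proof. by rewrite mxE !ord_of_idxK. Qed.

Lemma nabla_mx_tr (a : 'I_(2 * m.+2)) : (nabla_mx a)^T = - nabla_mx a.
Proof.
apply/matrixP => b c; rewrite !mxE.
case: (idx_of_ord a) (idx_of_ord b) (idx_of_ord c) => [||||i|i] [||||j|j] [||||k|k] //=;
  rewrite ?(eq_sym j i) ?(eq_sym k i) ?(eq_sym k j); ring.
Qed.

(** The form [v] applied to R(E_a, E_b) E_c. Nested linear forms replace matrix products, so no sum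
    is left and identities follow by cases on the indices and [ring]. *)
Definition curv a b c v : R :=
  nabla b a (fun e => nabla e c v) - nabla a b (fun e => nabla e c v)
  + nabla b c (fun e => nabla a e v) - nabla a c (fun e => nabla b e v).

Lemma frame_curv_nabla a b c d :
  frame_curv nabla_mx (ord_of_idx a) (ord_of_idx b) (ord_of_idx c) (ord_of_idx d) =
  curv a b c (dl d).
Proof.
rewrite /frame_curv /curv.
have mxDB (M N P : 'M[R]_(2 * m.+2)) i j : (M + N - P) i j = M i j + N i j - P i j.
  by rewrite !mxE.
rewrite mxDB summxE !mulmx_coef.
have E x y z : nabla x y (fun e => nabla e z (dl d)) =
   \sum_e nabla_mx (ord_of_idx x) (ord_of_idx y) e * nabla_mx e (ord_of_idx z) (ord_of_idx d).
  by rewrite sum_nabla_mx; congr nabla; apply/funext => e; rewrite nabla_mxE.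
have E' x y z : nabla x y (fun e => nabla z e (dl d)) =
   \sum_e nabla_mx (ord_of_idx x) (ord_of_idx y) e * nabla_mx (ord_of_idx z) e (ord_of_idx d).
  by rewrite sum_nabla_mx; congr nabla; apply/funext => e; rewrite nabla_mxE.
rewrite !E !E' -sumrB; congr (_ + _ - _).
by apply: eq_bigr => e _; rewrite [LHS]mxE mulrBl.
Qed.

Lemma sum_ord_cst (c : R) : \sum_(i < m) c = m%:R * c.
Proof. by rewrite sumr_const card_ord mulr_natl. Qed.

Lemma sum_ordD1 (j : 'I_m) (F : 'I_m -> R) :
  \sum_(i < m) F i = F j + \sum_(i < m | i != j) F i.
Proof. by rewrite (bigD1 j). Qed.

Lemma sum_ord_neq (j : 'I_m) (c : R) : \sum_(i < m | i != j) c = (m%:R - 1) * c.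
Proof.
rewrite sumr_const cardC1 card_ord -[X in X%:R](ltn_predK (ltn_ord j)).
by rewrite -natr1 addrK mulr_natl.
Qed.

(** The constant can be read on P: ad P is symmetric with eigenvalue 1 on Z and 1/2 on each X_i and
    Y_i, and Ric(P, P) is minus the trace of its square. For Q the eigenvalues are 1 on U, -1/2 on
    X_i and 1/2 on Y_i. *)
Lemma einstein_alg b c : \sum_a curv a b c (dl a) = - (1 + m%:R / 2) * dl b c.
Proof.
rewrite big_idx /curv.
Local Ltac sum_const_ord := repeat (under eq_bigr => ? _ do rewrite ?eqxx; rewrite sum_ord_cst).
Local Ltac sum_split_at j := rewrite !(sum_ordD1 j);
  repeat (under eq_bigr => ? ? do (rewrite ?eqxx; match goal with H : is_true (?i != j) |- _ => rewrite ?(eq_sym j i) ?(negbTE H) end); rewrite sum_ord_neq).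
case: b c => [||||j|j] [||||k|k] /=; rewrite ?eqxx.
(* Sums over ['I_m] are evaluated in one of three ways: [m] equal terms; one term at [j] and [m - 1]
   equal ones; or, for distinct [j] and [k], terms that all vanish. *)
all: try by (sum_const_ord; rewrite /=; field).
all: try (match goal with x : 'I_m |- _ => by (sum_split_at x; rewrite ?eqxx /=; field) end).
all: have [<-|jk] := eqVneq j k; [by (sum_split_at j; rewrite ?eqxx /=; field)|].
all: rewrite ?big1 => [|i _|i _]; rewrite ?(negbTE jk) /=; try ring.
all: have [->|ik] := eqVneq i k; rewrite ?(eq_sym k j) ?(negbTE jk) ?eqxx /=; ring.
Qed.

(** [nabla iP] and [nabla iQ] are zero, so in R(E_a, E_b) only the derivative along the bracket
    survives. *)
Lemma curvPQ a b c v : a = iP \/ a = iQ ->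
  curv a b c v = nabla b a (fun e => nabla e c v).
Proof.
by rewrite /curv; case=> -> /=; case: b => [||||i|i]; case: c => [||||j|j] /=; ring.
Qed.

(** For every b other than P and Q, the derivative of P or of Q along E_b is a nonzero multiple of
    E_b. By [curvPQ] the matrix of R(P, E_b) or R(Q, E_b) is then the same multiple of [nabla_mx] at
    b; at P and Q, [nabla_mx] vanishes. *)
Lemma curv_parallel (C : 'M[R]_(2 * m.+2)) :
  (forall a b : 'I_(2 * m.+2), frame_curv nabla_mx a b *m C = C *m frame_curv nabla_mx a b) ->
  forall a : 'I_(2 * m.+2), nabla_mx a *m C = C *m nabla_mx a.
Proof.
move=> RC.
have curvE a b : a = iP \/ a = iQ -> frame_curv nabla_mx (ord_of_idx a) (ord_of_idx b) =
    \matrix_(c, d) nabla b a (fun e => nabla e (idx_of_ord c) (dl (idx_of_ord d))).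
  move=> aPQ; apply/matrixP => c d; rewrite mxE -(idx_of_ordK c) -(idx_of_ordK d).
  by rewrite frame_curv_nabla curvPQ // !ord_of_idxK.
have Bx b : nabla_mx (ord_of_idx b) = \matrix_(c, d) nabla b (idx_of_ord c) (dl (idx_of_ord d)).
  by apply/matrixP => c d; rewrite !mxE !ord_of_idxK.
have key a b (k : R) : a = iP \/ a = iQ -> k != 0 ->
    (forall v : idx m -> R, nabla b a v = k * v b) ->
    nabla_mx (ord_of_idx b) *m C = C *m nabla_mx (ord_of_idx b).
  move=> aPQ k0 bk; have := RC (ord_of_idx a) (ord_of_idx b).
  have -> : frame_curv nabla_mx (ord_of_idx a) (ord_of_idx b) = k *: nabla_mx (ord_of_idx b).
    by rewrite curvE // Bx; apply/matrixP => c d; rewrite !mxE bk.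
  by rewrite -scalemxAl -scalemxAr => /(scalerI k0).
have z0 b : nabla_mx (ord_of_idx b) = 0 -> nabla_mx (ord_of_idx b) *m C = C *m nabla_mx (ord_of_idx b).
  by move=> ->; rewrite mul0mx mulmx0.
move=> a; rewrite -(idx_of_ordK a); case: (idx_of_ord a) => [||||i|i].
- by apply: z0; rewrite Bx; apply/matrixP => c d; rewrite !mxE.
- by apply: z0; rewrite Bx; apply/matrixP => c d; rewrite !mxE.
- by apply: (key iQ _ (-1)); rewrite ?oppr_eq0 ?oner_eq0; auto => v /=; rewrite mulN1r.
- by apply: (key iP _ (-1)); rewrite ?oppr_eq0 ?oner_eq0; auto => v /=; rewrite mulN1r.
- by apply: (key iP _ (- 2^-1)); rewrite ?oppr_eq0 ?invr_eq0 ?pnatr_eq0; auto => v /=; rewrite mulNr.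
- by apply: (key iP _ (- 2^-1)); rewrite ?oppr_eq0 ?invr_eq0 ?pnatr_eq0; auto => v /=; rewrite mulNr.
Qed.

(** Commutation determines all rows of [C] from the row of P, where only the entries at P and Z
    survive: [C] is r + s J0, with J0 the Kaehler structure, and multiplies like a complex
    number. *)
Lemma commutant_idempotent (C : 'M[R]_(2 * m.+2)) : (0 < m)%N ->
  (forall a : 'I_(2 * m.+2), nabla_mx a *m C = C *m nabla_mx a) -> C *m C = C -> C = 0 \/ C = 1%:M.
Proof.
move=> m0 BC CC.
pose D b c := C (ord_of_idx b) (ord_of_idx c).
have comm a b c : nabla a b (fun e => D e c) = - nabla a c (D b).
  have /matrixP/(_ (ord_of_idx b) (ord_of_idx c)) := BC (ord_of_idx a).
  rewrite !mulmx_coef (sum_nabla_mx a b (fun e => C e (ord_of_idx c))) => ->.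
  rewrite -sum_nabla_mx -sumrN; apply: eq_bigr => e _.
  by have /matrixP/(_ (ord_of_idx c) e) := nabla_mx_tr (ord_of_idx a); rewrite !mxE => ->; rewrite mulrN mulrC.
have DD b c : \sum_e D b e * D e c = D b c.
  have /matrixP/(_ (ord_of_idx b) (ord_of_idx c)) := CC.
  by rewrite mulmx_coef big_ord_idx.
have DZ c : D iZ c = nabla iZ c (D iP) by have /= := comm iZ iP c; lra.
have DP c : D iP c = - nabla iZ c (D iZ) by have /= := comm iZ iZ c; lra.
have DU c : D iU c = nabla iU c (D iQ) by have /= := comm iU iQ c; lra.
have DQ c : D iQ c = - nabla iU c (D iU) by have /= := comm iU iU c; lra.
have DX i c : D (iX i) c = 2 * nabla (iX i) c (D iP) by have /= := comm (iX i) iP c; lra.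
have DX' i c : D (iX i) c = - 2 * nabla (iX i) c (D iQ) by have /= := comm (iX i) iQ c; lra.
have DY i c : D (iY i) c = 2 * nabla (iY i) c (D iP) by have /= := comm (iY i) iP c; lra.
have PQ : D iP iQ = 0 by have /= := DP iQ; lra.
have PU : D iP iU = 0 by have /= := DP iU; lra.
have PX i : D iP (iX i) = 0 by have /= := DP (iX i); have /= := DZ (iY i); lra.
have PY i : D iP (iY i) = 0 by have /= := DP (iY i); have /= := DZ (iX i); lra.
have QP : D iQ iP = 0 by have /= := DQ iP; lra.
have QZ : D iQ iZ = 0 by have /= := DQ iZ; lra.
have QX i : D iQ (iX i) = 0 by have /= := DQ (iX i); have /= := DU (iY i); lra.
have QY i : D iQ (iY i) = 0 by have /= := DQ (iY i); have /= := DU (iX i); lra.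
have [i0 _] : exists i : 'I_m, true by exists (Ordinal m0).
(* An X direction is reached from both P and Q, which ties the P-Z plane to the Q-U plane. Without
   such a direction the space would be a product of two hyperbolic planes. *)
have QQ : D iQ iQ = D iP iP.
  have := DX i0 (iX i0); rewrite DX' /= eqxx !mul1r; lra.
have QU : D iQ iU = D iP iZ.
  have := DX i0 (iY i0); rewrite DX' /= eqxx !mul1r; lra.
have ZP : D iZ iP = - D iP iZ by have /= := DZ iP; lra.
have ZZ : D iZ iZ = D iP iP by have /= := DZ iZ; lra.
have E1 := DD iP iP; have E2 := DD iP iZ.
move: E1 E2; rewrite !big_idx PQ PU ZP ZZ.
rewrite !big1 => [E1 E2|i _|i _|i _|i _]; try by rewrite ?PX ?PY mul0r.
(* With r and s the entries at P and Z, idempotence reads r^2 - s^2 = r and 2 r s = s. If s were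
   nonzero then r = 1/2 and s^2 = -1/4. *)
have PZ : D iP iZ = 0.
  have /eqP : D iP iZ * (2 * D iP iP - 1) = 0 by lra.
  rewrite mulf_eq0 => /orP[/eqP //|/eqP H].
  have : D iP iP = 2^-1 by lra.
  by move: E1 => /[swap] ->; nra.
have CE : C = (D iP iP)%:M.
  apply/matrixP => b c; rewrite -(idx_of_ordK b) -(idx_of_ordK c).
  rewrite mxE -[LHS]/(D _ _) (can_eq (@ord_of_idxK m)) -mulr_natr -dlE.
  case: (idx_of_ord b) (idx_of_ord c) => [||||i|i] [||||j|j];
    rewrite ?ZP ?ZZ ?QQ ?QU ?PX ?PY ?QX ?QY ?PZ ?PQ ?PU ?QP ?QZ /=; try lra;
    rewrite ?DZ ?DU ?DX ?DY /= ?ZP ?ZZ ?QQ ?QU ?PX ?PY ?QX ?QY ?PZ ?PQ ?PU ?QP ?QZ; lra.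
have : D iP iP * (D iP iP - 1) == 0 by apply/eqP; move: E1; rewrite PZ; lra.
rewrite mulf_eq0 subr_eq0 => /orP[/eqP d0|/eqP d1]; [left|right]; rewrite CE.
  by rewrite d0 raddf0.
by rewrite d1.
Qed.

End LeviCivita.

(** * Metric and almost complex structure *)

Section Expr.
Context {R : realType} {m : nat}.
Local Notation N := (2 * m.+2)%N.

(* A syntax closed under partial derivatives, so that these can be computed. *)
Inductive expr :=
| Cst of R | Co of idx m | Add of expr & expr | Mul of expr & expr | Exp of expr.

Fixpoint eval (x : 'rV[R]_N) (e : expr) : R :=
  match e with
  | Cst r => r
  | Co a => x 0 (ord_of_idx a)
  | Add e1 e2 => eval x e1 + eval x e2
  | Mul e1 e2 => eval x e1 * eval x e2
  | Exp e => expR (eval x e)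
  end.

Fixpoint dexpr (b : idx m) (e : expr) : expr :=
  match e with
  | Cst r => Cst 0
  | Co a => Cst (dl a b)
  | Add e1 e2 => Add (dexpr b e1) (dexpr b e2)
  | Mul e1 e2 => Add (Mul (dexpr b e1) e2) (Mul e1 (dexpr b e2))
  | Exp e => Mul (Exp e) (dexpr b e)
  end.

Lemma Ck_eval k U (e : expr) : open U -> Ck k U (eval^~ e).
Proof.
move=> oU; elim: e => [r|a|e1 IH1 e2 IH2|e1 IH1 e2 IH2|e IH] /=.
- exact: Ck_cst.
- exact: Ck_coord.
- exact: CkD.
- exact: CkM.
- exact: Ck_expR.
Qed.

Lemma differentiable_eval e x : differentiable (eval^~ e) x.
Proof. exact: (Ck_eval 0 e openT).1. Qed.

Lemma partial_eval b e x :
  partial (ord_of_idx b) (eval^~ e) x = eval x (dexpr b e).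
Proof.
elim: e => [r|a|e1 IH1 e2 IH2|e1 IH1 e2 IH2|e IH] /=.
- by rewrite /partial derive_cst.
- rewrite partial_coord dlE; congr (_%:R); congr nat_of_bool.
  by apply: can_eq; exact: ord_of_idxK.
- rewrite -IH1 -IH2; apply: partialD; exact: differentiable_eval.
- rewrite -IH1 -IH2 /partial.
  have := @deriveM R _ (eval^~ e1) (eval^~ e2) x (delta_mx 0 (ord_of_idx b))
    (diff_derivable (differentiable_eval e1 x)) (diff_derivable (differentiable_eval e2 x)).
  move=> E; apply: etrans E _; rewrite addrC; congr (_ + _); exact: mulrC.
- by rewrite -IH; apply: partial_expR; exact: differentiable_eval.
Qed.

Definition Opp e := Mul (Cst (-1)) e.
Definition eA := Exp (Mul (Cst 2^-1) (Add (Co iQ) (Opp (Co iP)))).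
Definition eC := Exp (Opp (Co iQ)).
Definition eA' := Exp (Mul (Cst 2^-1) (Add (Co iP) (Opp (Co iQ)))).
Definition eC' := Exp (Co iQ).

Definition th_expr (i a : idx m) : expr :=
  match i, a with
  | iP, iP => Cst 1
  | iQ, iQ => Cst 1
  | iU, iU => eC
  | iZ, iZ => Mul (Mul eA eA) eC
  | iX i, iX j => Mul (Cst (i == j)%:R) eA
  | iX i, iY j => Mul (Cst (- (i == j)%:R)) (Mul (Co iU) (Mul eA eC))
  | iX i, iZ => Mul (Cst (- 1)) (Mul (Co (iY i)) (Mul (Mul eA eA) eC))
  | iY i, iY j => Mul (Cst (i == j)%:R) (Mul eA eC)
  | _, _ => Cst 0
  end.

Definition E_expr (a i : idx m) : expr :=
  match a, i with
  | iP, iP => Cst 1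
  | iQ, iQ => Cst 1
  | iU, iU => eC'
  | iZ, iZ => Mul (Mul eA' eA') eC'
  | iX i, iX j => Mul (Cst (i == j)%:R) eA'
  | iX i, iY j => Mul (Cst (i == j)%:R) (Mul (Co iU) eA')
  | iX i, iZ => Mul (Co (iY i)) eA'
  | iY i, iY j => Mul (Cst (i == j)%:R) (Mul eA' eC')
  | _, _ => Cst 0
  end.

Definition coframe (x : 'rV[R]_N) : 'M[R]_N :=
  \matrix_(i, a) eval x (th_expr (idx_of_ord i) (idx_of_ord a)).

Definition frame (x : 'rV[R]_N) : 'M[R]_N :=
  \matrix_(a, i) eval x (E_expr (idx_of_ord a) (idx_of_ord i)).

Lemma coframeE x i a : coframe x (ord_of_idx i) (ord_of_idx a) = eval x (th_expr i a).
Proof. by rewrite mxE !ord_of_idxK. Qed.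

Lemma frameE x a i : frame x (ord_of_idx a) (ord_of_idx i) = eval x (E_expr a i).
Proof. by rewrite mxE !ord_of_idxK. Qed.

Lemma Ck_coframe k : Ck k setT coframe.
Proof.
apply/Ck_mxP; first exact: openT.
move=> i a; rewrite (_ : (fun y => _) = eval^~ (th_expr (idx_of_ord i) (idx_of_ord a))).
  by apply: Ck_eval; exact: openT.
by apply/funext => y; rewrite mxE.
Qed.

Lemma Ck_frame k : Ck k setT frame.
Proof.
apply/Ck_mxP; first exact: openT.
move=> i a; rewrite (_ : (fun y => _) = eval^~ (E_expr (idx_of_ord i) (idx_of_ord a))).
  by apply: Ck_eval; exact: openT.
by apply/funext => y; rewrite mxE.
Qed.

(** A row of the coframe paired with [v], its sums already carried out ([sum_coframe]); [Eact] does
    the same for the frame. *)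
Definition thact x (i : idx m) (v : idx m -> R) : R :=
  let a := eval x eA in let c := eval x eC in
  match i with
  | iP => v iP
  | iQ => v iQ
  | iU => c * v iU
  | iZ => a * a * c * v iZ
  | iX i => a * v (iX i) - eval x (Co iU) * (a * c) * v (iY i)
            - eval x (Co (iY i)) * (a * a * c) * v iZ
  | iY i => a * c * v (iY i)
  end.

Lemma sum_delta (i : 'I_m) (v : 'I_m -> R) : \sum_j (i == j)%:R * v j = v i.
Proof.
rewrite (bigD1 i) //= big1 ?addr0 ?eqxx ?mul1r // => j ji.
by rewrite eq_sym (negbTE ji) mul0r.
Qed.

Lemma sum_coframe x i v : \sum_a eval x (th_expr i a) * v a = thact x i v.
Proof.
rewrite big_idx /thact; case: i => [||||i|i] /=.
1-4: by rewrite !big1 => [|j _|j _]; rewrite ?mul0r //; ring.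
- set a := expR _; set c := expR _.
  have -> : \sum_j (i == j)%:R * a * v (iX j) = a * v (iX i).
    by rewrite -(sum_delta i (fun j => a * v (iX j))); apply: eq_bigr => j _; ring.
  have -> : \sum_j - (i == j)%:R * (x 0 (ord_of_idx iU) * (a * c)) * v (iY j) =
     - (x 0 (ord_of_idx iU) * (a * c)) * v (iY i).
    rewrite -(sum_delta i (fun j => - (x 0 (ord_of_idx iU) * (a * c)) * v (iY j))).
    by apply: eq_bigr => j _; ring.
  ring.
- set a := expR _; set c := expR _.
  have -> : \sum_j (i == j)%:R * (a * c) * v (iY j) = a * c * v (iY i).
    by rewrite -(sum_delta i (fun j => a * c * v (iY j))); apply: eq_bigr => j _; ring.
  by rewrite big1 => [|j _]; rewrite ?mul0r //; ring.
Qed.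

Definition Eact x (a : idx m) (v : idx m -> R) : R :=
  let a' := eval x eA' in let c' := eval x eC' in
  match a with
  | iP => v iP
  | iQ => v iQ
  | iU => c' * v iU
  | iZ => a' * a' * c' * v iZ
  | iX i => a' * (v (iX i) + eval x (Co iU) * v (iY i) + eval x (Co (iY i)) * v iZ)
  | iY i => a' * c' * v (iY i)
  end.

Lemma sum_frame x a v : \sum_i eval x (E_expr a i) * v i = Eact x a v.
Proof.
rewrite big_idx /Eact; case: a => [||||i|i] /=.
1-4: by rewrite !big1 => [|j _|j _]; rewrite ?mul0r //; ring.
- set a := expR _.
  have -> : \sum_j (i == j)%:R * a * v (iX j) = a * v (iX i).
    by rewrite -(sum_delta i (fun j => a * v (iX j))); apply: eq_bigr => j _; ring.
  have -> : \sum_j (i == j)%:R * (x 0 (ord_of_idx iU) * a) * v (iY j) =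
     x 0 (ord_of_idx iU) * a * v (iY i).
    rewrite -(sum_delta i (fun j => x 0 (ord_of_idx iU) * a * v (iY j))).
    by apply: eq_bigr => j _; ring.
  ring.
- set a := expR _; set c := expR _.
  have -> : \sum_j (i == j)%:R * (a * c) * v (iY j) = a * c * v (iY i).
    by rewrite -(sum_delta i (fun j => a * c * v (iY j))); apply: eq_bigr => j _; ring.
  by rewrite big1 => [|j _]; rewrite ?mul0r //; ring.
Qed.

Lemma eA'E x : eval x eA' = (eval x eA)^-1.
Proof. by rewrite /= -expRN; congr expR; ring. Qed.

Lemma eC'E x : eval x eC' = (eval x eC)^-1.
Proof. by rewrite /= -expRN; congr expR; ring. Qed.

Lemma eA_neq0 x : eval x eA != 0.
Proof. by rewrite gt_eqF // expR_gt0. Qed.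

Lemma eC_neq0 x : eval x eC != 0.
Proof. by rewrite gt_eqF // expR_gt0. Qed.

Lemma ord_matrixP (C D : 'M[R]_N) :
  (forall i j : idx m, C (ord_of_idx i) (ord_of_idx j) = D (ord_of_idx i) (ord_of_idx j)) ->
  C = D.
Proof.
by move=> CD; apply/matrixP => i j; rewrite -(idx_of_ordK i) -(idx_of_ordK j).
Qed.

Lemma coframeK x : coframe x *m frame x = 1%:M.
Proof.
apply: ord_matrixP => i j; rewrite mulmx_coef big_ord_idx mxE (can_eq (@ord_of_idxK m)).
under eq_bigr do rewrite coframeE frameE.
rewrite (sum_coframe x i (fun a => eval x (E_expr a j))) -dlE /thact.
have aE := eA'E x; have cE := eC'E x; have a0 := eA_neq0 x; have c0 := eC_neq0 x.
case: i j => [||||i|i] [||||j|j]; move: aE cE a0 c0; rewrite /= => aE cE a0 c0;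
  rewrite ?aE ?cE; (try by ring); by field; rewrite ?a0 ?c0.
Qed.

Lemma frameK x : frame x *m coframe x = 1%:M.
Proof. exact: mulmx1C (coframeK x). Qed.

Lemma partial_coframe b i a x :
  partial (ord_of_idx b) (fun y => coframe y (ord_of_idx i) (ord_of_idx a) : R) x =
  eval x (dexpr b (th_expr i a)).
Proof.
rewrite -partial_eval; congr partial; apply/funext => y; exact: coframeE.
Qed.

(** The link between coordinates and algebra: the brackets encoded by [nabla] are those of the
    explicit coframe. *)
Lemma coframe_structure : structure_eq setT coframe (@nabla_mx R m).
Proof.
move=> x _ i j c; rewrite -(idx_of_ordK i) -(idx_of_ordK j) -(idx_of_ordK c).
move: (idx_of_ord i) (idx_of_ord j) (idx_of_ord c) => {}i {}j {}c.
rewrite !partial_coframe.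
have -> : \sum_a \sum_b coframe x (ord_of_idx i) a * coframe x (ord_of_idx j) b *
     (nabla_mx b a (ord_of_idx c) - nabla_mx a b (ord_of_idx c)) =
   thact x i (fun a => thact x j (fun b => nabla b a (dl c) - nabla a b (dl c))).
  rewrite -sum_coframe big_ord_idx; apply: eq_bigr => a _.
  rewrite -sum_coframe big_ord_idx mulr_sumr; apply: eq_bigr => b _.
  by rewrite !nabla_mxE !coframeE mulrA.
rewrite /thact.
case: i j c => [||||i|i] [||||j|j] [||||k|k] /=.
all: try (match goal with y : 'I_m, z : 'I_m, w : 'I_m |- _ =>
  rewrite ?(eq_sym w z) ?(eq_sym w y) ?(eq_sym z y) end); try (match goal with y : 'I_m, z : 'I_m |- _ => rewrite ?(eq_sym z y) end); try by field.
Qed.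

(* [v] applied to J E_a; changing the sign on Q and U gives the Kaehler structure. *)
Definition Jact (a : idx m) (v : idx m -> R) : R :=
  match a with
  | iP => v iZ
  | iQ => - v iU
  | iU => v iQ
  | iZ => - v iP
  | iX i => - v (iY i)
  | iY i => v (iX i)
  end.

Definition Jfr : 'M[R]_N := \matrix_(a, b) Jact (idx_of_ord a) (dl (idx_of_ord b)).

Lemma sum_Jfr a (v : 'I_N -> R) :
  \sum_b Jfr (ord_of_idx a) b * v b = Jact a (fun b => v (ord_of_idx b)).
Proof.
rewrite big_ord_idx; under eq_bigr do rewrite mxE !ord_of_idxK.
case: a => [||||i|i] /=; rewrite -?(sum_dl _ (fun b => v (ord_of_idx b))) -?sumrN;
  by apply: eq_bigr => b _; rewrite dlC ?mulNr.
Qed.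

Lemma Jfr_sqr : Jfr *m Jfr = - 1%:M.
Proof.
apply: ord_matrixP => i j; rewrite mulmx_coef sum_Jfr !mxE (can_eq (@ord_of_idxK m)) -dlE.
by case: i j => [||||i|i] [||||j|j]; rewrite /= !mxE !ord_of_idxK //= ?opprK ?oppr0 ?(eq_sym j).
Qed.

Lemma Jfr_tr : Jfr^T = - Jfr.
Proof.
apply: ord_matrixP => i j; rewrite !mxE !ord_of_idxK.
by case: i j => [||||i|i] [||||j|j] //=; rewrite ?opprK ?oppr0 // eq_sym.
Qed.

Definition metric (x : 'rV[R]_N) : 'M[R]_N := coframe x *m (coframe x)^T.
Definition acs (x : 'rV[R]_N) : 'M[R]_N := coframe x *m Jfr *m frame x.

Lemma smooth_metric : smooth_on setT metric.
Proof.
apply/smooth_onP => k; apply: Ck_mulmx; first exact: openT.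
  exact: Ck_coframe.
by apply: Ck_trmx; [exact: openT|exact: Ck_coframe].
Qed.

Lemma smooth_acs : smooth_on setT acs.
Proof.
apply/smooth_onP => k; apply: Ck_mulmx; first exact: openT.
  apply: (@Ck_mulmx _ _ _ _ _ _ _ _ coframe (fun=> Jfr)); first exact: openT.
    exact: Ck_coframe.
  exact: Ck_cst.
exact: Ck_frame.
Qed.

Lemma metric_tr x : (metric x)^T = metric x.
Proof. by rewrite /metric trmx_mul trmxK. Qed.

Lemma metric_sqr (v : 'rV[R]_N) x :
  (v *m metric x *m v^T) 0 0 = \sum_a (v *m coframe x) 0 a ^+ 2.
Proof.
rewrite /metric mulmxA -mulmxA -trmx_mul mulmx_coef.
by apply: eq_bigr => a _; rewrite [_^T _ _]mxE expr2.
Qed.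

Lemma metric_gt0 x (v : 'rV[R]_N) : v != 0 -> 0 < (v *m metric x *m v^T) 0 0.
Proof.
move=> v0; rewrite metric_sqr lt0r sumr_ge0 => [|a _]; last exact: sqr_ge0.
rewrite andbT; apply: contra v0; rewrite psumr_eq0 => [|a _]; last exact: sqr_ge0.
move=> /allP H; have : v *m coframe x = 0.
  apply/rowP => a; rewrite [RHS]mxE; apply/eqP; rewrite -sqrf_eq0.
  by apply: H; rewrite mem_index_enum.
by move=> H1; rewrite -[v]mulmx1 -(coframeK x) mulmxA H1 mul0mx.
Qed.

Lemma acs_sqr x : acs x *m acs x = - 1%:M.
Proof.
rewrite /acs -!mulmxA (mulmxA (frame x)) frameK mul1mx (mulmxA Jfr) Jfr_sqr.
by rewrite mulNmx mul1mx mulmxN coframeK.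
Qed.

Lemma acs_metric x : acs x *m metric x = coframe x *m Jfr *m (coframe x)^T.
Proof. by rewrite /acs /metric -!mulmxA (mulmxA (frame x)) frameK mul1mx. Qed.

Lemma acs_orth x : acs x *m metric x *m (acs x)^T = metric x.
Proof.
rewrite acs_metric /acs !trmx_mul -!mulmxA (mulmxA (coframe x)^T) -(trmx_mul (frame x)) frameK.
rewrite trmx1 mul1mx (mulmxA Jfr) Jfr_tr mulmxN Jfr_sqr opprK mul1mx.
by [].
Qed.

(** Symbolic counterpart of [thact], as [JactE] is of [Jact], which turns the components of the
    fundamental form into an [expr] that [dexpr] can differentiate. *)
Definition thactE (i : idx m) (v : idx m -> expr) : expr :=
  match i with
  | iP => v iP
  | iQ => v iQ
  | iU => Mul eC (v iU)
  | iZ => Mul (Mul (Mul eA eA) eC) (v iZ)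
  | iX i => Add (Mul eA (v (iX i))) (Add (Opp (Mul (Mul (Co iU) (Mul eA eC)) (v (iY i))))
              (Opp (Mul (Mul (Co (iY i)) (Mul (Mul eA eA) eC)) (v iZ))))
  | iY i => Mul (Mul eA eC) (v (iY i))
  end.

Definition JactE (a : idx m) (v : idx m -> expr) : expr :=
  match a with
  | iP => v iZ
  | iQ => Opp (v iU)
  | iU => v iQ
  | iZ => Opp (v iP)
  | iX i => Opp (v (iY i))
  | iY i => v (iX i)
  end.

Definition om_expr i j := thactE i (fun a => JactE a (th_expr j)).

Lemma om_exprE x i j :
  (acs x *m metric x) (ord_of_idx i) (ord_of_idx j) = eval x (om_expr i j).
Proof.
rewrite acs_metric -mulmxA mulmx_coef big_ord_idx.
have JE a : (Jfr *m (coframe x)^T) (ord_of_idx a) (ord_of_idx j) =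
    eval x (JactE a (th_expr j)).
  rewrite mulmx_coef sum_Jfr.
  by case: a => [||||k|k] /=; rewrite mxE coframeE ?mulN1r.
under eq_bigr do rewrite coframeE JE.
rewrite (sum_coframe x i (fun a => eval x (JactE a (th_expr j)))) /om_expr.
by case: i => [||||k|k] //; rewrite /thact; cbn [thactE eval Opp]; ring.
Qed.

(** The form is d(U - Z); its closedness is checked on symbolic derivatives, for each kind of index
    triple. *)
Lemma closed_fundamental : closed_2form_on setT (fun x => acs x *m metric x).
Proof.
move=> x _ i j k; rewrite -(idx_of_ordK i) -(idx_of_ordK j) -(idx_of_ordK k).
move: (idx_of_ord i) (idx_of_ord j) (idx_of_ord k) => {}i {}j {}k.
have pE b i1 j1 : partial (ord_of_idx b) (fun y =>
    (acs y *m metric y) (ord_of_idx i1) (ord_of_idx j1) : R^o) x =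
    eval x (dexpr b (om_expr i1 j1)).
  rewrite -partial_eval; congr partial; apply/funext => y; exact: om_exprE.
rewrite !pE.
case: i j k => [||||i|i] [||||j|j] [||||k|k] /=.
all: try (match goal with y : 'I_m, z : 'I_m, w : 'I_m |- _ =>
  rewrite ?(eq_sym w z) ?(eq_sym w y) ?(eq_sym z y) end); try (match goal with y : 'I_m, z : 'I_m |- _ => rewrite ?(eq_sym z y) end); try by field.
Qed.

Lemma ricci_metric x : ricci metric x = - (1 + m%:R / 2) *: metric x.
Proof.
apply: (@ricciE _ _ _ setT metric coframe frame (@nabla_mx R m)) => //.
- exact: openT.
- by move=> y _; exact: coframeK.
- by move=> y _; exact: frameK.
- exact: nabla_mx_tr.
- exact: Ck_coframe.
- exact: Ck_frame.
- exact: coframe_structure.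
- move=> b c; rewrite -(idx_of_ordK b) -(idx_of_ordK c) big_ord_idx.
  rewrite (can_eq (@ord_of_idxK m)) -dlE -einstein_alg.
  by apply: eq_bigr => a _; rewrite frame_curv_nabla.
Qed.

End Expr.

(** * Irreducibility *)

Section Jacobian.
Context {R : realType} {d q : nat}.
Variables (U : set 'rV[R]_d) (V : set 'rV[R]_q).
Variables (f : 'rV[R]_d -> 'rV[R]_q) (f' : 'rV[R]_q -> 'rV[R]_d).

Lemma jacobian_inv y : diffeomorphism U V f f' -> V y ->
  'J f' y *m 'J f (f' y) = 1%:M.
Proof.
move=> [[oU oV] [sf sf'] fK f'K] Vy; have [Uy fy] := f'K y Vy.
have df : differentiable f (f' y) by exact: smooth_on_diff sf Uy.
have df' : differentiable f' y by exact: smooth_on_diff sf' Vy.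
apply/matrixP => a b; rewrite mulmx_coef.
have dfb : differentiable (fun x => f x 0 b : R) (f' y).
  exact: ((differentiable_mxP _ _).1 df).
under eq_bigr do rewrite !jacobianE //.
have := partial_comp a df' dfb => <-; rewrite mxE eq_sym -(partial_coord a b y).
apply: (eq_partial oV); last by rewrite inE.
by move=> z; rewrite inE => Vz; have [_ ->] := f'K z Vz.
Qed.

End Jacobian.

Lemma diffeomorphism_sym (R : realType) d q (U : set 'rV[R]_d) (V : set 'rV[R]_q) f f' :
  diffeomorphism U V f f' -> diffeomorphism V U f' f.
Proof. by move=> [[? ?] [? ?] ? ?]; split. Qed.

(** * Pull-back of a coframe and of its structure equations *)

Section Pullback.
Context {R : realType} {d q n : nat}.
Variables (U : set 'rV[R]_d) (V : set 'rV[R]_q).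
Variables (f' : 'rV[R]_q -> 'rV[R]_d).
Variables (th : 'rV[R]_d -> 'M[R]_(d, n)) (B : 'I_n -> 'M[R]_n).
Hypotheses (oU : open U) (oV : open V) (sf' : smooth_on V f').
Hypothesis VU : forall y, V y -> U (f' y).
Hypothesis Cth : forall k, Ck k U th.
Hypothesis str : structure_eq U th B.

Lemma Ck_jacobian k : Ck k V (jacobian f').
Proof.
apply/(Ck_mxP oV) => a i.
have Cf : Ck k.+1 V (fun y => f' y 0 i : R).
  exact: ((Ck_mxP oV _ _).1 ((smooth_onP V f').1 sf' k.+1)).
apply: (eq_Ck oV _ (Cf.2 a)) => y; rewrite inE => Vy.
by rewrite jacobianE //; exact: smooth_on_diff sf' Vy.
Qed.

Lemma Ck_comp_mx p r k (F : 'rV[R]_d -> 'M[R]_(p, r)) :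
  Ck k U F -> Ck k V (fun y => F (f' y)).
Proof.
move=> /(Ck_mxP oU) CF; apply/(Ck_mxP oV) => i j.
apply: (@Ck_comp _ _ V oV _ U k f' (fun x => F x i j : R)) => //.
exact: (smooth_onP V f').1.
Qed.

(** Rectangular because in product coordinates [q] is [k + l] while [n] is the dimension of the
    model, and the two types differ even though the numbers agree. *)
Definition pullback y : 'M[R]_(q, n) := 'J f' y *m th (f' y).

Lemma Ck_pullback k : Ck k V pullback.
Proof. by apply: Ck_mulmx; [exact: oV|exact: Ck_jacobian|apply: Ck_comp_mx]. Qed.

Lemma partial_pullback a b c y : V y ->
  partial a (fun y => pullback y b c : R) y =
  \sum_i (partial a (partial b (fun y => f' y 0 i : R)) y * th (f' y) i c
    + 'J f' y b i * \sum_j 'J f' y a j * partial j (fun x => th x i c : R) (f' y)).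
Proof.
move=> Vy.
have df' z : V z -> differentiable f' z by exact: smooth_on_diff.
have Cf i : Ck 2 V (fun y => f' y 0 i : R).
  exact: ((Ck_mxP oV _ _).1 ((smooth_onP V f').1 sf' 2)).
have dth x i : U x -> differentiable (fun x => th x i c : R) x.
  by move=> Ux; apply: ((differentiable_mxP _ _).1 ((Cth 0).1 x Ux)).
have E : {in V, (fun y => pullback y b c : R) =1
    (fun y => \sum_i partial b (fun y => f' y 0 i : R) y * th (f' y) i c)}.
  move=> z; rewrite inE => Vz; rewrite /pullback mulmx_coef.
  by apply: eq_bigr => i _; rewrite jacobianE //; exact: df'.
have Vy' : y \in V by rewrite inE.
apply: etrans (eq_partial oV a E Vy') _.
have dp i : differentiable (partial b (fun y => f' y 0 i : R)) y.
  exact: ((Cf i).2 b).1.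
have dc i : differentiable (fun y => th (f' y) i c : R) y.
  exact: (differentiable_comp (df' _ Vy) (dth _ i (VU Vy))).
apply: etrans (partial_sum a _) _ => [i|]; first exact: differentiableM.
apply: eq_bigr => i _.
have := deriveM (diff_derivable (v := delta_mx 0 a) (dp i)) (diff_derivable (v := delta_mx 0 a) (dc i)).
move=> E1; apply: etrans E1 _; rewrite addrC; congr (_ + _).
  by rewrite [LHS]mulrC.
rewrite jacobianE; last exact: df'.
congr (_ * _).
apply: etrans (partial_comp a (df' _ Vy) (dth _ i (VU Vy))) _.
by apply: eq_bigr => j _; rewrite jacobianE //; exact: df'.
Qed.

(** Exterior differentiation commutes with pull-back: the second derivatives [H] of the change of
    variables are common to both sums and cancel. *)
Lemma pullback_alg (Ja Jb : 'I_d -> R) (H : 'I_d -> R) (t : 'M[R]_(d, n))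
   (D : 'I_d -> 'I_d -> R) (T : 'I_n -> 'I_n -> R) c :
  (forall i j, D i j - D j i = \sum_p \sum_r t i p * t j r * T p r) ->
  \sum_i (H i * t i c + Jb i * \sum_j Ja j * D j i)
  - \sum_i (H i * t i c + Ja i * \sum_j Jb j * D j i) =
  \sum_p \sum_r (\sum_i Ja i * t i p) * (\sum_j Jb j * t j r) * T p r.
Proof.
move=> DT; rewrite -sumrB.
under eq_bigr do rewrite opprD addrACA subrr add0r.
rewrite sumrB.
have -> : \sum_i Jb i * (\sum_j Ja j * D j i) = \sum_i \sum_j Ja i * Jb j * D i j.
  rewrite exchange_big; apply: eq_bigr => j _ /=; rewrite mulr_sumr.
  by apply: eq_bigr => i _; ring.
have -> : \sum_i Ja i * (\sum_j Jb j * D j i) = \sum_i \sum_j Ja i * Jb j * D j i.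
  by apply: eq_bigr => i _; rewrite mulr_sumr; apply: eq_bigr => j _; rewrite mulrA.
rewrite -sumrB; under eq_bigr => i _.
  rewrite -sumrB; under eq_bigr => j _.
    rewrite -mulrBr DT mulr_sumr; under eq_bigr do rewrite mulr_sumr.
  over.
  rewrite exchange_big /=; under eq_bigr do rewrite exchange_big /=.
over.
rewrite exchange_big /=; apply: eq_bigr => p _.
rewrite exchange_big /=; apply: eq_bigr => r _.
rewrite mulr_suml mulr_suml; apply: eq_bigr => i _.
rewrite mulr_sumr mulr_suml; apply: eq_bigr => j _; ring.
Qed.

Lemma pullback_structure : structure_eq V pullback B.
Proof.
move=> y Vy a b c; rewrite !partial_pullback //.
have Cf i : Ck 2 V (fun y => f' y 0 i : R).
  exact: ((Ck_mxP oV _ _).1 ((smooth_onP V f').1 sf' 2)).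
have S i := Schwarz oV b a (Cf i) Vy.
under [X in X - _]eq_bigr do rewrite S.
have := pullback_alg ('J f' y a) ('J f' y b)
  (fun i => partial b (partial a (fun y => f' y 0 i : R)) y) c
  (fun i j => str (VU Vy) i j c).
move=> ->; apply: eq_bigr => p _; apply: eq_bigr => r _.
by rewrite /pullback !mulmx_coef.
Qed.

End Pullback.

(** * Curvature of a product metric *)

Section Product.
Context {R : realType} {q : nat}.
Variables (V : set 'rV[R]_q) (h : 'rV[R]_q -> 'M[R]_q) (blk : 'I_q -> bool).
Hypothesis oV : open V.
Hypothesis hV : forall y, V y -> h y \in unitmx.
Hypothesis h0 : forall y i j, blk i != blk j -> h y i j = 0.
Hypothesis hI : forall y a i j (t : R), blk a != blk i ->
  h (t *: delta_mx 0 a + y) i j = h y i j.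

Lemma partial_const_dir (W : normedModType R) (F : 'rV[R]_q -> W) a y :
  (forall t : R, F (t *: delta_mx 0 a + y) = F y) -> partial a F y = 0.
Proof.
move=> Fa; rewrite /partial /derive.
rewrite (_ : (fun _ => _) = fun=> 0); first exact: lim_cst.
by apply/funext => t /=; rewrite Fa subrr scaler0.
Qed.

(** Being block diagonal is commuting with the diagonal projection [D], a property that passes to
    the inverse. *)
Lemma invmx_block y i j : V y -> blk i != blk j -> invmx (h y) i j = 0.
Proof.
move=> Vy ij; have hy := hV Vy.
pose D : 'M[R]_q := diag_mx (\row_i (blk i)%:R).
have hD : h y *m D = D *m h y.
  apply/matrixP => a b; rewrite mul_mx_diag mul_diag_mx !mxE.
  have [ab|ab] := eqVneq (blk a) (blk b); first by rewrite ab mulrC.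
  by rewrite h0 // mul0r mulr0.
have : invmx (h y) *m D = D *m invmx (h y).
  by rewrite -[LHS]mulmx1 -(mulmxV hy) mulmxA -(mulmxA _ D) -hD mulmxA mulVmx // mul1mx.
move=> /matrixP/(_ i j); rewrite mul_mx_diag mul_diag_mx !mxE.
by move: ij; case: (blk i) (blk j) => -[] //= _; rewrite ?(mulr0, mul0r, mulr1, mul1r).
Qed.

Lemma partial_h0 a i j y : blk i != blk j -> partial a (fun z => h z i j : R^o) y = 0.
Proof. by move=> ij; apply: partial_const_dir => t; rewrite !h0. Qed.

Lemma partial_hI a i j y : blk a != blk i -> partial a (fun z => h z i j : R^o) y = 0.
Proof. by move=> ai; apply: partial_const_dir => t; rewrite hI. Qed.

(** Each derivative in the symbol is either that of an off-diagonal entry or one along a direction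
    of the other factor. *)
Lemma christoffel_block k i j y : V y -> blk k != blk j -> christoffel h k i j y = 0.
Proof.
move=> Vy kj; rewrite /christoffel big1 ?mulr0 // => l _.
have [kl|kl] := eqVneq (blk k) (blk l); last by rewrite invmx_block ?mul0r.
have jl : blk j != blk l by rewrite -kl eq_sym.
rewrite (partial_h0 i y jl) add0r.
have [ik|ik] := eqVneq (blk i) (blk k).
  have ij : blk i != blk j by rewrite ik.
  rewrite (partial_h0 l y ij) subr0 (@partial_hI j i) ?mulr0 //.
  by rewrite eq_sym.
have il : blk i != blk l by rewrite -kl.
rewrite (partial_h0 j y il) sub0r (@partial_hI l i) ?oppr0 ?mulr0 //.
by rewrite eq_sym.
Qed.

Lemma curvature_block l k i j y : V y -> blk l != blk k -> curvature h l k i j y = 0.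
Proof.
move=> Vy lk; have Vy' : y \in V by rewrite inE.
have Z a b : partial a (christoffel h l b k) y = 0.
  have E : {in V, christoffel h l b k =1 (fun=> 0 : R^o)}.
    by move=> z; rewrite inE => Vz; exact: christoffel_block.
  apply: etrans (eq_partial oV a E Vy') _.
  by apply: partial_const_dir.
rewrite /curvature !Z subrr add0r big1 // => p _.
have [lp|lp] := eqVneq (blk l) (blk p).
  have pk : blk p != blk k by rewrite -lp.
  by rewrite !(christoffel_block _ Vy pk) !mulr0 subrr.
by rewrite !(christoffel_block _ Vy lp) !mul0r subrr.
Qed.

End Product.

Section BlockCommutant.
Context {R : realType} {q n : nat}.
Variables (V : set 'rV[R]_q) (h : 'rV[R]_q -> 'M[R]_q) (blk : 'I_q -> bool).
Variables (th : 'rV[R]_q -> 'M[R]_(q, n)) (E : 'rV[R]_q -> 'M[R]_(n, q)).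
Variable B : 'I_n -> 'M[R]_n.
Hypothesis oV : open V.
Hypothesis h0 : forall y i j, blk i != blk j -> h y i j = 0.
Hypothesis hI : forall y a i j (t : R), blk a != blk i ->
  h (t *: delta_mx 0 a + y) i j = h y i j.
Hypothesis hE : forall x, V x -> h x = th x *m (th x)^T.
Hypothesis thE : forall x, V x -> th x *m E x = 1%:M.
Hypothesis Eth : forall x, V x -> E x *m th x = 1%:M.
Hypothesis BT : forall a, (B a)^T = - B a.
Hypothesis Cth : Ck 2 V th.
Hypothesis CE : Ck 1 V E.
Hypothesis str : structure_eq V th B.

Definition block_proj : 'M[R]_q := diag_mx (\row_i (blk i)%:R).

Lemma block_proj_idem : block_proj *m block_proj = block_proj.
Proof.
apply/matrixP => i j; rewrite mul_diag_mx !mxE.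
by case: (blk i); rewrite ?mul1r ?mul0r ?mul0rn.
Qed.

(** In coordinates the curvature operators preserve both blocks. Conjugating by the frame and
    contracting the two coordinate indices with [E] recovers [frame_curv]. *)
Lemma frame_curv_block_proj y a b : V y ->
  frame_curv B a b *m (E y *m block_proj *m th y) =
  E y *m block_proj *m th y *m frame_curv B a b.
Proof.
move=> Vy.
have hu z : V z -> h z \in unitmx.
  move=> Vz; have H : h z *m ((E z)^T *m E z) = 1%:M.
    by rewrite hE // mulmxA -(mulmxA (th z)) -trmx_mul Eth // trmx1 mulmx1 thE.
  by have [] := mulmx1_unit H.
pose G i j := curv_form th B i j y.
have GD i j : block_proj *m (th y *m G i j *m E y) = th y *m G i j *m E y *m block_proj.
  apply/matrixP => k l; rewrite mul_diag_mx mul_mx_diag !mxE.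
  have [->|kl] := eqVneq (blk k) (blk l); first by rewrite mulrC.
  have := curvature_block oV hu h0 hI (l := l) (k := k) i j Vy.
  rewrite eq_sym => /(_ kl).
  by rewrite (curvatureE oV hE thE Eth BT Cth CE str) // mxE => ->; rewrite mul0r mulr0.
have et : E y *m th y = 1%:M by exact: Eth.
set C := E y *m block_proj *m th y.
have GC i j : G i j *m C = C *m G i j.
  have H : C *m G i j *m (E y *m th y) = E y *m th y *m G i j *m C.
    rewrite /C; transitivity (E y *m (block_proj *m (th y *m G i j *m E y)) *m th y).
      by rewrite !mulmxA.
    by rewrite GD !mulmxA.
  by move: H; rewrite et mulmx1 mul1mx => ->.
have RG : frame_curv B a b = \sum_i \sum_j (E y a i * E y b j) *: G i j.
  have e1 c c' : \sum_i E y c i * th y i c' = (c == c')%:R.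
    by rewrite -mulmx_coef et mxE.
  rewrite /G /curv_form; move: (E y) (th y) e1 => e t e1.
  transitivity (\sum_c \sum_c' ((\sum_i e a i * t i c) * (\sum_j e b j * t j c')) *:
      frame_curv B c c').
    under eq_bigr do under eq_bigr do rewrite !e1.
    rewrite (bigD1 a) //= [X in _ + X]big1 ?addr0 => [|c ca]; last first.
      by rewrite big1 // => c' _; rewrite eq_sym (negbTE ca) mul0r scale0r.
    rewrite (bigD1 b) //= [X in _ + X]big1 ?addr0 => [|c cb]; last first.
      by rewrite [b == c]eq_sym (negbTE cb) mulr0 scale0r.
    by rewrite !eqxx mulr1 scale1r.
  transitivity (\sum_c \sum_c' \sum_i \sum_j
      ((e a i * t i c) * (e b j * t j c')) *: frame_curv B c c').
    apply: eq_bigr => c _; apply: eq_bigr => c' _; rewrite mulr_suml scaler_suml.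
    by apply: eq_bigr => i _; rewrite mulr_sumr scaler_suml.
  under eq_bigr => c _.
    rewrite exchange_big /=; under eq_bigr => i _ do rewrite exchange_big /=.
  over.
  rewrite exchange_big /=; apply: eq_bigr => i _.
  rewrite exchange_big /=; apply: eq_bigr => j _.
  rewrite scaler_sumr; apply: eq_bigr => c _.
  rewrite scaler_sumr; apply: eq_bigr => c' _.
  by rewrite scalerA; congr (_ *: _); ring.
rewrite RG mulmx_suml mulmx_sumr; apply: eq_bigr => i _.
rewrite mulmx_suml mulmx_sumr; apply: eq_bigr => j _.
by rewrite -scalemxAl GC scalemxAr.
Qed.

End BlockCommutant.

Lemma conj_idem (R : realType) q n (t : 'M[R]_(q, n)) (e : 'M[R]_(n, q)) (D : 'M[R]_q) :
  t *m e = 1%:M -> D *m D = D -> (e *m D *m t) *m (e *m D *m t) = e *m D *m t.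
Proof.
by move=> te DD; rewrite !mulmxA -(mulmxA (e *m D)) te mulmx1 -(mulmxA e) DD.
Qed.

Lemma conjK (R : realType) q n (t : 'M[R]_(q, n)) (e : 'M[R]_(n, q)) (D : 'M[R]_q) :
  t *m e = 1%:M -> D = t *m (e *m D *m t) *m e.
Proof. by move=> te; rewrite !mulmxA te mul1mx -mulmxA te mulmx1. Qed.

Section NoProduct.
Context {R : realType} {m : nat}.
Local Notation N := (2 * m.+2)%N.

Lemma metric_not_product (U : set 'rV[R]_N) k l (V1 : set 'rV[R]_k)
    (V2 : set 'rV[R]_l) h1 h2 (f : 'rV[R]_N -> 'rV[R]_(k + l)) f' x0 :
  (0 < m)%N -> (0 < k)%N -> (0 < l)%N -> U x0 ->
  diffeomorphism U [set y | V1 (lsubmx y) /\ V2 (rsubmx y)] f f' ->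
  ~ (forall x, U x ->
      metric x = 'J f x *m block_mx (h1 (lsubmx (f x))) 0
                                     0 (h2 (rsubmx (f x))) *m ('J f x)^T).
Proof.
move=> m0 k0 l0 Ux0 diff gE; set V := [set y | _] in diff.
have [[oU oV] [sf sf'] fK f'K] := diff.
pose h y : 'M[R]_(k + l) := block_mx (h1 (lsubmx y)) 0 0 (h2 (rsubmx y)).
pose blk (i : 'I_(k + l)) : bool := (i < k)%N.
have blkl (i : 'I_k) : blk (lshift l i) = true by rewrite /blk /= ltn_ord.
have blkr (i : 'I_l) : blk (rshift k i) = false by rewrite /blk /= ltnNge leq_addr.
have h0 y i j : blk i != blk j -> h y i j = 0.
  rewrite /h; case: (split_ordP i) => i' ->; case: (split_ordP j) => j' ->;
    rewrite ?blkl ?blkr // => _; rewrite ?block_mxEur ?block_mxEdl mxE //.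
have hI y a i j (t : R) : blk a != blk i -> h (t *: delta_mx 0 a + y) i j = h y i j.
  rewrite /h; case: (split_ordP a) => a' ->; case: (split_ordP i) => i' ->;
    case: (split_ordP j) => j' ->; rewrite ?blkl ?blkr // => _;
    rewrite ?block_mxEul ?block_mxEdr ?block_mxEur ?block_mxEdl ?mxE //.
    congr (h2 _ _ _); apply/rowP => c; rewrite !mxE.
    by rewrite (_ : (_ == lshift l a') = false) ?andbF ?mulr0 ?add0r //; apply/negbTE/eqP => /(congr1 blk); rewrite blkl blkr.
  congr (h1 _ _ _); apply/rowP => c; rewrite !mxE.
  by rewrite (_ : (_ == rshift k a') = false) ?andbF ?mulr0 ?add0r //; apply/negbTE/eqP => /(congr1 blk); rewrite blkl blkr.
have VU y : V y -> U (f' y) by case/f'K.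
have JJ y : V y -> 'J f' y *m 'J f (f' y) = 1%:M by exact: (jacobian_inv diff).
have JJ' y : V y -> 'J f (f' y) *m 'J f' y = 1%:M.
  move=> Vy; have := jacobian_inv (diffeomorphism_sym diff) (VU y Vy).
  by have [_ ->] := f'K y Vy.
pose th := pullback f' (@coframe R m).
pose E y := @frame R m (f' y) *m 'J f (f' y).
have thE y : V y -> th y *m E y = 1%:M.
  by move=> Vy; rewrite /th /E /pullback mulmxA -(mulmxA ('J f' y)) coframeK mulmx1 JJ.
have Eth y : V y -> E y *m th y = 1%:M.
  by move=> Vy; rewrite /th /E /pullback mulmxA -(mulmxA (frame _)) JJ' // mulmx1 frameK.
have hE y : V y -> h y = th y *m (th y)^T.
  move=> Vy; rewrite /th /pullback trmx_mul mulmxA -(mulmxA ('J f' y)) -/(metric (f' y)).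
  rewrite gE; last exact: VU.
  have [_ ->] := f'K y Vy.
  by rewrite -/(h y) !mulmxA JJ // mul1mx -mulmxA -trmx_mul JJ // trmx1 mulmx1.
have Cc K : Ck K U (@coframe R m) by apply: (Ck_subset (@subsetT _ U)); exact: Ck_coframe.
have str : structure_eq V th (@nabla_mx R m).
  apply: (pullback_structure oV sf' VU Cc).
  by move=> x Ux; exact: coframe_structure.
have Cth : Ck 2 V th by exact: (Ck_pullback oU oV sf' VU Cc).
have CE : Ck 1 V E.
  apply: (Ck_mulmx oV).
    by apply: (Ck_comp_mx oU oV sf' VU); apply: (Ck_subset (@subsetT _ U)); exact: Ck_frame.
  by apply: (Ck_comp_mx oU oV sf' VU); exact: (Ck_jacobian oU sf).
pose y0 := f x0; have Vy0 : V y0 by case: (fK x0 Ux0).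
(* The projection on the first factor at [y0], rewritten in the frame. *)
pose C := E y0 *m block_proj blk *m th y0.
have CC : C *m C = C by apply: conj_idem; [exact: thE|exact: block_proj_idem].
have DC : block_proj blk = th y0 *m C *m E y0 by apply: conjK; exact: thE.
have BC := curv_parallel (fun a b =>
  frame_curv_block_proj oV h0 hI hE thE Eth (@nabla_mx_tr R m) Cth CE str a b Vy0).
have {BC CC}C01 : C = 0 \/ C = 1%:M by exact: (commutant_idempotent m0 BC CC).
clearbody C; have Ety0 := thE y0 Vy0; clearbody E th.
case: C01 DC => -> DC.
  have /matrixP/(_ (lshift l (Ordinal k0)) (lshift l (Ordinal k0))) := DC.
  rewrite mulmx0 mul0mx !mxE eqxx blkl => /eqP.
  by rewrite oner_eq0.
have /matrixP/(_ (rshift k (Ordinal l0)) (rshift k (Ordinal l0))) := DC.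
rewrite mulmx1 Ety0 !mxE eqxx blkr => /eqP.
by rewrite eq_sym oner_eq0.
Qed.

End NoProduct.

(** * Non-integrability *)

Section FrameBracket.
Context {R : realType} {d n : nat}.
Variables (U : set 'rV[R]_d).
Variables (th : 'rV[R]_d -> 'M[R]_(d, n)) (E : 'rV[R]_d -> 'M[R]_(n, d)).
Variable B : 'I_n -> 'M[R]_n.
Hypothesis oU : open U.
Hypothesis thE : forall x, U x -> th x *m E x = 1%:M.
Hypothesis Eth : forall x, U x -> E x *m th x = 1%:M.
Hypothesis Cth : Ck 1 U th.
Hypothesis CE : Ck 1 U E.
Hypothesis str : structure_eq U th B.

Definition frame_deriv a (w : 'rV[R]_d -> R) x : R :=
  \sum_i E x a i * partial i w x.

Lemma frame_deriv_diff a w x : Ck 2 U w -> U x ->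
  differentiable (frame_deriv a w) x.
Proof.
move=> Cw Ux; apply: differentiable_bigsum => i; apply: differentiableM.
  exact: ((differentiable_mxP _ _).1 (CE.1 x Ux)).
exact: (Cw.2 i).1.
Qed.

Lemma eq_frame_deriv a w w' x : {in U, w =1 w'} -> U x ->
  frame_deriv a w x = frame_deriv a w' x.
Proof.
move=> ww' Ux; apply: eq_bigr => i _; congr (_ * _).
by apply: (eq_partial oU i ww'); rewrite inE.
Qed.

Lemma frame_derivN a w x : differentiable w x ->
  frame_deriv a (fun y => - w y) x = - frame_deriv a w x.
Proof.
move=> dw; rewrite /frame_deriv -sumrN; apply: eq_bigr => i _.
rewrite -mulrN; congr (_ * _); rewrite /partial.
by have := deriveN (diff_derivable (v := delta_mx 0 i) dw).
Qed.

Lemma partial_frame_deriv i w x : U x ->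
  partial i w x = \sum_a th x i a * frame_deriv a w x.
Proof.
move=> Ux; have : th x *m E x *m \col_j partial j w x = \col_j partial j w x.
  by rewrite thE // mul1mx.
move=> /matrixP/(_ i 0); rewrite -mulmxA mulmx_coef => E1.
have -> : partial i w x = (\col_j partial j w x : 'cV[R]_d) i 0 by rewrite mxE.
rewrite -E1; apply: eq_bigr => a _.
by rewrite mulmx_coef; congr (_ * _); apply: eq_bigr => j _; rewrite mxE.
Qed.

Lemma bracket_alg (t : 'M[R]_(d, n)) (e : 'M[R]_(n, d)) (P : 'M[R]_(d, n))
    (K : 'M[R]_n) : e *m t = 1%:M ->
  P *m t^T - (P *m t^T)^T + t *m K *m t^T = 0 -> e *m P - (e *m P)^T + K = 0.
Proof.
move=> et H.
have : e *m (P *m t^T - (P *m t^T)^T + t *m K *m t^T) *m e^T = 0.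
  by rewrite H mulmx0 mul0mx.
have te : t^T *m e^T = 1%:M by rewrite -trmx_mul et trmx1.
rewrite mulmxDr mulmxBr mulmxDl mulmxBl !trmx_mul trmxK !mulmxA et !mul1mx.
by rewrite -!(mulmxA _ t^T) te !mulmx1.
Qed.

(** Dual form of the structure equation, obtained by expanding the symmetry of the second partials
    of [w] in the coframe. *)
Lemma frame_bracket a b w x : Ck 2 U w -> U x ->
  frame_deriv a (frame_deriv b w) x - frame_deriv b (frame_deriv a w) x =
  \sum_c (B a b c - B b a c) * frame_deriv c w x.
Proof.
move=> Cw Ux.
have dfd c : differentiable (frame_deriv c w) x by exact: frame_deriv_diff.
have dth i c : differentiable (fun y => th y i c : R) x.
  exact: ((differentiable_mxP _ _).1 (Cth.1 x Ux)).
have pp j i : partial j (partial i w) x = \sum_c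
   (th x i c * partial j (frame_deriv c w) x
    + frame_deriv c w x * partial j (fun y => th y i c : R) x).
  have E1 : {in U, partial i w =1 (fun y => \sum_c th y i c * frame_deriv c w y)}.
    by move=> y; rewrite inE => Uy; exact: partial_frame_deriv.
  have Ux' : x \in U by rewrite inE.
  apply: etrans (eq_partial oU j E1 Ux') _.
  apply: etrans (partial_sum j _) _ => [c|]; first exact: differentiableM.
  apply: eq_bigr => c _.
  exact: (deriveM (diff_derivable (v := delta_mx 0 j) (dth i c))
    (diff_derivable (v := delta_mx 0 j) (dfd c))).
pose P : 'M[R]_(d, n) := \matrix_(j, c) partial j (frame_deriv c w) x.
pose K : 'M[R]_n := \matrix_(p, r) \sum_c (B r p c - B p r c) * frame_deriv c w x.
have H : P *m (th x)^T - (P *m (th x)^T)^T + th x *m K *m (th x)^T = 0.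
  apply/matrixP => j i.
  have := Schwarz oU i j Cw Ux; rewrite !pp => /eqP; rewrite -subr_eq0 => /eqP.
  rewrite !big_split /= opprD addrACA => H0.
  have S1 k l : (P *m (th x)^T) k l = \sum_c th x l c * partial k (frame_deriv c w) x.
    by rewrite mulmx_coef; apply: eq_bigr => c _; rewrite !mxE mulrC.
  have S2 : (th x *m K *m (th x)^T) j i =
      \sum_c frame_deriv c w x * partial j (fun y => th y i c : R) x -
      \sum_c frame_deriv c w x * partial i (fun y => th y j c : R) x.
    have -> : (th x *m K *m (th x)^T) j i =
        \sum_p \sum_r th x j p * K p r * th x i r.
      rewrite mulmx_coef exchange_big; apply: eq_bigr => r _ /=.
      by rewrite mulmx_coef mulr_suml mxE.
    have K1 c := str Ux j i c.
    rewrite -sumrB; under [RHS]eq_bigr do rewrite -mulrBr K1 mulr_sumr.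
    rewrite [RHS]exchange_big; apply: eq_bigr => p _ /=.
    under [RHS]eq_bigr do rewrite mulr_sumr.
    rewrite [RHS]exchange_big; apply: eq_bigr => r _ /=.
    rewrite mxE mulr_sumr mulr_suml.
    by apply: eq_bigr => c _; ring.
  have mxDB (M M' M'' : 'M[R]_d) : (M - M'^T + M'') j i = M j i - M' i j + M'' j i.
    by rewrite !mxE.
  by rewrite mxDB !S1 S2 H0 mxE.
have /matrixP/(_ a b) := bracket_alg (Eth Ux) H.
have mxDB (M M' M'' : 'M[R]_n) : (M - M'^T + M'') a b = M a b - M' b a + M'' a b.
  by rewrite !mxE.
have S3 k l : (E x *m P) k l = frame_deriv k (frame_deriv l w) x.
  by rewrite mulmx_coef; apply: eq_bigr => i _; rewrite mxE.
rewrite mxDB !S3 !mxE => /eqP; rewrite addr_eq0 => /eqP ->.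
by rewrite -sumrN; apply: eq_bigr => c _; ring.
Qed.

End FrameBracket.

Section NonIntegrable.
Context {R : realType} {m : nat}.
Local Notation N := (2 * m.+2)%N.

(** The real and imaginary parts of the coordinates satisfy Cauchy-Riemann equations along the
    frame; together with the brackets of Q, U with X, Y they force the derivatives along X to
    vanish. *)
Lemma acs_not_integrable (U : set 'rV[R]_N) k (V : set 'rV[R]_(k + k)) f f' x :
  (0 < m)%N -> U x -> diffeomorphism U V f f' ->
  ~ (forall x, U x -> acs x *m 'J f x = 'J f x *m standard_J k).
Proof.
move=> m0 Ux diff JE.
have [[oU oV] [sf sf'] fK f'K] := diff.
have thE y : U y -> coframe y *m frame y = 1%:M by move=> _; exact: coframeK.
have Eth y : U y -> frame y *m coframe y = 1%:M by move=> _; exact: frameK.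
have Cth : Ck 1 U (@coframe R m) by apply: (Ck_subset (@subsetT _ U)); exact: Ck_coframe.
have CE : Ck 1 U (@frame R m) by apply: (Ck_subset (@subsetT _ U)); exact: Ck_frame.
have str : structure_eq U (@coframe R m) (@nabla_mx R m).
  by move=> y Uy; exact: coframe_structure.
pose w c (y : 'rV[R]_N) : R := f y 0 c.
have Cw c : Ck 2 U (w c).
  exact: ((Ck_mxP oU _ _).1 ((smooth_onP U f).1 sf 2)).
pose D a := frame_deriv (@frame R m) (ord_of_idx a).
have DJ a c y : U y -> D a (w c) y = (frame y *m 'J f y) (ord_of_idx a) c.
  move=> Uy; rewrite mulmx_coef; apply: eq_bigr => i _; rewrite jacobianE //.
  exact: smooth_on_diff sf Uy.
have br a b c : D a (D b (w c)) x - D b (D a (w c)) x =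
    nabla a b (fun e => D e (w c) x) - nabla b a (fun e => D e (w c) x).
  have := frame_bracket oU thE Eth Cth CE str (ord_of_idx a) (ord_of_idx b) (Cw c) Ux.
  rewrite /D => ->.
  rewrite -(sum_nabla_mx a b (fun e => frame_deriv (@frame R m) e (w c) x)).
  rewrite -(sum_nabla_mx b a (fun e => frame_deriv (@frame R m) e (w c) x)).
  by rewrite -sumrB; apply: eq_bigr => e _; exact: mulrBl.
have dD a c y : U y -> differentiable (D a (w c)) y.
  by move=> Uy; exact: (frame_deriv_diff CE).
have DN a b c : D a (fun y => - D b (w c) y) x = - D a (D b (w c)) x.
  by apply: frame_derivN; exact: dD.
have JW a c y : U y -> Jact a (fun e => D e (w c) y) =
    (frame y *m 'J f y *m standard_J k) (ord_of_idx a) c.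
  move=> Uy; rewrite -mulmxA -JE // mulmxA /acs !mulmxA frameK mul1mx -mulmxA.
  rewrite mulmx_coef sum_Jfr; case: a => [||||i|i] /=; by rewrite DJ.
have stdl (W : 'M[R]_(N, k + k)) a (c : 'I_k) :
    (W *m standard_J k) a (lshift k c) = - W a (rshift k c).
  rewrite -[W]hsubmxK /standard_J mul_row_block !mulmx0 addr0 add0r row_mxEl.
  by rewrite mulmxN mulmx1 mxE row_mxEr.
have stdr (W : 'M[R]_(N, k + k)) a (c : 'I_k) :
    (W *m standard_J k) a (rshift k c) = W a (lshift k c).
  rewrite -[W]hsubmxK /standard_J mul_row_block !mulmx0 !addr0 row_mxEr.
  by rewrite mulmx1 row_mxEl.
(* With [Jr], this says that the left component plus sqrt(-1) times the right one is
   J-holomorphic. *)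
have Jl a c y : U y -> Jact a (fun e => D e (w (lshift k c)) y) = - D a (w (rshift k c)) y.
  by move=> Uy; rewrite JW // stdl DJ.
have Jr a c y : U y -> Jact a (fun e => D e (w (rshift k c)) y) = D a (w (lshift k c)) y.
  by move=> Uy; rewrite JW // stdr DJ.
have DE a b b' c c' : (forall y, U y -> D b (w c) y = D b' (w c') y) ->
    D a (D b (w c)) x = D a (D b' (w c')) x.
  by move=> bb'; apply: (eq_frame_deriv _ oU _ _ Ux) => y; rewrite inE; exact: bb'.
have DEN a b b' c c' : (forall y, U y -> D b (w c) y = - D b' (w c') y) ->
    D a (D b (w c)) x = - D a (D b' (w c')) x.
  move=> bb'; rewrite -DN; apply: (eq_frame_deriv _ oU _ _ Ux) => y.
  by rewrite inE; exact: bb'.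
pose i0 := Ordinal m0; pose X : idx m := iX i0; pose Y : idx m := iY i0.
(* Real form of the commutator of Q - iU and X - iY: the eight bracket identities and the
   Cauchy-Riemann equations form a linear system whose second-order terms cancel, leaving the two
   derivatives zero. *)
have X0 c : D X (w (lshift k c)) x = 0 /\ D X (w (rshift k c)) x = 0.
  set al := w (lshift k c); set be := w (rshift k c).
  have UQ y : U y -> D iU al y = D iQ be y.
    by move=> Uy; have /= := Jl iQ c y Uy => /oppr_inj.
  have UQ' y : U y -> D iU be y = - D iQ al y.
    by move=> Uy; have /= <- := Jr iQ c y Uy; rewrite opprK.
  have YX y : U y -> D Y al y = D X be y.
    by move=> Uy; have /= := Jl X c y Uy => /oppr_inj.
  have YX' y : U y -> D Y be y = - D X al y.
    by move=> Uy; have /= <- := Jr X c y Uy; rewrite opprK.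
  have := br iQ X (lshift k c); have := br iU Y (lshift k c).
  have := br iQ Y (lshift k c); have := br iU X (lshift k c).
  have := br iQ X (rshift k c); have := br iU Y (rshift k c).
  have := br iQ Y (rshift k c); have := br iU X (rshift k c).
  rewrite -/al -/be /=.
  rewrite !(DE _ _ _ _ _ UQ) !(DE _ _ _ _ _ YX) !(DEN _ _ _ _ _ UQ') !(DEN _ _ _ _ _ YX').
  rewrite ?(YX x Ux) ?(YX' x Ux).
  move: (D iQ (D X be) x) (D iQ (D X al) x) (D iU (D X al) x) (D iU (D X be) x).
  move: (D X (D iQ al) x) (D X (D iQ be) x) (D Y (D iQ al) x) (D Y (D iQ be) x).
  move: (D X al x) (D X be x) => xa xb q1 q2 q3 q4 q5 q6 q7 q8 *; split; lra.
have W0 c : (frame x *m 'J f x) (ord_of_idx X) c = 0.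
  rewrite -DJ //; case: (split_ordP c) => c' ->; [exact: (X0 c').1|exact: (X0 c').2].
have JJ := jacobian_inv (diffeomorphism_sym diff) Ux.
(* This product is invertible, whereas by [W0] its left factor has a zero row at X. *)
have : frame x *m 'J f x *m ('J f' (f x) *m coframe x) = 1%:M.
  by rewrite !mulmxA -(mulmxA (frame x)) JJ mulmx1 frameK.
move=> /matrixP/(_ (ord_of_idx X) (ord_of_idx X)).
rewrite mulmx_coef big1 => [|c _]; last by rewrite W0 mul0r.
by rewrite mxE eqxx => /eqP; rewrite eq_sym oner_eq0.
Qed.

End NonIntegrable.

(** * Completeness *)

Section EuclideanSpace.
Context {R : realType} (d : nat).

Lemma rV_hausdorff : hausdorff_space 'rV[R]_d.
Proof. exact: norm_hausdorff. Qed.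

Lemma rV_second_countable : @second_countable 'rV[R]_d.
Proof.
pose F (qn : 'rV[rat]_d * nat) : set 'rV[R]_d :=
  ball (map_mx ratr qn.1 : 'rV[R]_d) (qn.2.+1%:R^-1).
exists (range F).
  rewrite -bigcup_imset1; apply: bigcup_countable => [|qn _]; last exact: countable1.
  exact: countableP.
split=> [_ [qn _ <-]|x A]; first exact: ball_open.
move=> /nbhs_ballP[e /= e0 xA].
have [n] : exists n, 0 + n.+1%:R^-1 < e / 2 by apply: ltr_add_invr; rewrite divr_gt0.
rewrite add0r => ne; set r : R := n.+1%:R^-1 in ne.
have r0 : 0 < r by rewrite invr_gt0 ltr0n.
have ex i : exists q : rat, ratr q \in `]x 0 i - r, x 0 i + r[.
  by apply: rat_in_itvoo; rewrite ltrBlDr -addrA ltrDl addr_gt0.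
have [q qP] := choice ex.
have xq : ball (map_mx ratr (\row_i q i) : 'rV[R]_d) r x.
  split=> // i j; rewrite (ord1 i) !mxE -ball_normE /= ltr_norml.
  by have := qP j; rewrite in_itv /= => /andP[]; lra.
exists (F (\row_i q i, n)); first by split=> //; exists (\row_i q i, n).
move=> y qy; apply: xA; rewrite [e]splitr.
apply: (@ball_triangle _ _ (map_mx ratr (\row_i q i) : 'rV[R]_d)).
  by apply: ball_sym; exact: le_ball (ltW ne) _ xq.
exact: le_ball (ltW ne) _ qy.
Qed.

Lemma rV_connected : connected [set: 'rV[R]_d].
Proof.
have -> : [set: 'rV[R]_d] = \bigcup_(x in setT) ((fun t : R => t *: (x : 'rV[R]_d)) @` `[0, 1]).
  apply/seteqP; split=> // x _; exists x => //; exists 1; rewrite ?scale1r //=.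
  by rewrite in_itv /= ler01 lexx.
apply: bigcup_connected.
  by exists 0 => x _; exists 0; rewrite ?scale0r //= in_itv /= ler01 lexx.
move=> x _; apply: connected_continuous_connected; first exact: segment_connected.
by apply: continuous_subspaceT; exact: scalel_continuous.
Qed.

End EuclideanSpace.

Section Integral.
Context {R : realType}.
Local Notation mu := (@lebesgue_measure R).

Lemma itv01_integrable (s : R -> R) : continuous s ->
  mu.-integrable `[0, 1] (EFin \o s).
Proof.
move=> cs; apply: continuous_compact_integrable; first exact: segment_compact.
exact: continuous_subspaceT.
Qed.

Lemma increment_le_integral (F F' s : R -> R) (C ell : R) :
  (forall t : R, is_derive t (1 : R) F (F' t)) -> continuous F' -> continuous s ->
  (forall t, 0 <= t <= 1 -> `|F' t| <= C * s t) ->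
  (\int[mu]_(t in `[0%R, 1%R]) (s t)%:E = ell%:E)%E ->
  `|F 1 - F 0| <= C * ell.
Proof.
move=> dF cF' cs Fs I.
have cF : continuous F.
  by move=> t; apply/differentiable_continuous/derivable1_diffP; case: (dF t).
have FTC : (\int[mu]_(t in `[0%R, 1%R]) (F' t)%:E = (F 1)%:E - (F 0)%:E)%E.
  apply: continuous_FTC2 => //; first exact: continuous_subspaceT.
    split; first by move=> t _; case: (dF t).
      exact/cvg_at_right_filter/cF.
    exact/cvg_at_left_filter/cF.
  by move=> t _; rewrite derive1E derive_val.
have E1 : \int[mu]_(t in `[0, 1]) F' t = F 1 - F 0 by rewrite /Rintegral FTC.
have E2 : \int[mu]_(t in `[0, 1]) (C * s t) = C * ell.
  rewrite RintegralZl //; last exact: itv01_integrable.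
  by rewrite /Rintegral I.
have cC : continuous (fun t => C * s t).
  by move=> t; apply: continuousM; [exact: cst_continuous|exact: cs].
rewrite -E1 -E2; apply: le_trans (le_normr_Rintegral _ _) _ => //.
  exact: itv01_integrable.
apply: le_Rintegral => //.
- apply: (itv01_integrable (s := fun t => `|F' t|)) => t.
  by apply: continuous_comp; [exact: cF'|exact: norm_continuous].
- exact: itv01_integrable.
Qed.

Lemma itv01_integral_le (s : R -> R) : continuous s ->
  exists2 ell, (\int[mu]_(t in `[0%R, 1%R]) (s t)%:E = ell%:E)%E &
    forall c, (forall t, 0 <= t <= 1 -> s t <= c) -> ell <= c.
Proof.
move=> cs; have si := itv01_integrable cs.
exists (\int[mu]_(t in `[0, 1]) s t).
  by rewrite /Rintegral fineK //; exact: integrable_fin_num si.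
move=> c sc.
have -> : c = \int[mu]_(t in `[0, 1]) (cst c t).
  rewrite Rintegral_cst //= lebesgue_measure_itv /= lte_fin ltr01.
  by rewrite -EFinB subr0 mulr1.
apply: le_Rintegral => //; first exact: (itv01_integrable (s := cst c) (@cst_continuous _ _ c)).
Qed.

End Integral.

(** * Bounds by the inequality of arithmetic and geometric means *)

Section RealBounds.
Context {R : realFieldType}.
Implicit Types x y z u w a c : R.

Lemma amgm2 x y : `|x * y| <= (x ^+ 2 + y ^+ 2) / 2.
Proof.
have h1 := sqr_ge0 (x + y); have h2 := sqr_ge0 (x - y).
by rewrite ler_norml; apply/andP; split; nra.
Qed.

Lemma sqr_amgm2 x y : (x * y) ^+ 2 <= (x ^+ 4 + y ^+ 4) / 2.
Proof.
have := amgm2 (x ^+ 2) (y ^+ 2); rewrite -exprMn ger0_norm ?sqr_ge0 //.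
by rewrite -!exprM.
Qed.

Lemma pow4_amgm2 x y : (x * y) ^+ 4 <= (x ^+ 8 + y ^+ 8) / 2.
Proof.
have := sqr_amgm2 (x ^+ 2) (y ^+ 2); rewrite -exprMn -!exprM.
by [].
Qed.

Lemma sqr_le1 x : x <= (1 + x ^+ 2) / 2.
Proof. by have := sqr_ge0 (x - 1); nra. Qed.

Lemma even_ge0 x n : 0 <= x ^+ (n * 2).
Proof. by rewrite exprM sqr_ge0. Qed.

Lemma pow248_bound x : [/\ 0 <= x ^+ 2, 0 <= x ^+ 4, 0 <= x ^+ 8 & 0 <= x ^+ 16] /\
  [/\ x ^+ 2 <= 1 + x ^+ 16, x ^+ 4 <= 1 + x ^+ 16 & x ^+ 8 <= 1 + x ^+ 16].
Proof.
have h2 : 0 <= x ^+ 2 := even_ge0 x 1; have h4 : 0 <= x ^+ 4 := even_ge0 x 2.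
have h8 : 0 <= x ^+ 8 := even_ge0 x 4; have h16 : 0 <= x ^+ 16 := even_ge0 x 8.
have := sqr_le1 (x ^+ 2); have := sqr_le1 (x ^+ 4); have := sqr_le1 (x ^+ 8).
rewrite -!exprM => *; split; split => //; lra.
Qed.

(** Here and below [a] and [c] stand for the frame coefficients [eA'] and [eC']. Splitting c u^7 as
    (c u^3) u^4, then c^2 u^6 as (c u)^2 u^4, leaves only u^8 and c^8, and the latter is at most 1 +
    c^16. *)
Lemma bound_U c u : `|c * (u ^+ 7)| <= 1 + c ^+ 16 + u ^+ 8.
Proof.
have [[c2 c4 c8 c16] [d2 d4 d8]] := pow248_bound c.
have u8 : 0 <= u ^+ 8 := even_ge0 u 4.
have := amgm2 (c * u ^+ 3) (u ^+ 4).
rewrite -mulrA -exprD exprMn -!exprM.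
have := amgm2 (c ^+ 2 * u ^+ 2) (u ^+ 4).
rewrite -mulrA -exprD -exprMn (_ : (c * u) ^+ 2 ^+ 2 = (c * u) ^+ 4); last by rewrite -exprM.
rewrite exprMn ger0_norm; last by rewrite mulr_ge0 // (even_ge0 u 3).
have := pow4_amgm2 c u; rewrite exprMn -!exprM /= ; lra.
Qed.

(** The worst monomial is a u y^3: it is split successively into y^4, (a u)^4 and finally a^8 and
    u^8, which explains the exponents 4 and 8. *)
Lemma bound_X a u x y z :
  `|a * (2 * x + u * (4 * y ^+ 3) + y * (2 * z))| <=
  8 * (1 + a ^+ 16 + u ^+ 8 + x ^+ 2 + y ^+ 4 + z ^+ 2).
Proof.
have [[a2 a4 a8 a16] [d2 d4 d8]] := pow248_bound a.
have u8 : 0 <= u ^+ 8 := even_ge0 u 4.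
have x2 := sqr_ge0 x; have z2 := sqr_ge0 z; have y4 : 0 <= y ^+ 4 := even_ge0 y 2.
have h1 := amgm2 a x.
have h2 := amgm2 (a * u * y) (y ^+ 2).
have h3 := sqr_amgm2 (a * u) y; have h4 := pow4_amgm2 a u.
have h5 := amgm2 (a * y) z; have h6 := sqr_amgm2 a y.
rewrite -exprM /= in h2.
have -> : a * (2 * x + u * (4 * y ^+ 3) + y * (2 * z)) =
   2 * (a * x) + 4 * (a * u * y * y ^+ 2) + 2 * (a * y * z) by ring.
have t1 := ler_normD (2 * (a * x) + 4 * (a * u * y * y ^+ 2)) (2 * (a * y * z)).
have t2 := ler_normD (2 * (a * x)) (4 * (a * u * y * y ^+ 2)).
rewrite !(normrM 2) !normr_nat in t1; rewrite (normrM 2) (normrM 4) !normr_nat in t2; lra.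
Qed.

Lemma bound_Y a c y : `|a * c * (4 * y ^+ 3)| <= 4 * (1 + a ^+ 16 + c ^+ 16 + y ^+ 4).
Proof.
have [[a2 a4 a8 a16] [d2 d4 d8]] := pow248_bound a.
have [[c2 c4 c8 c16] [e2 e4 e8]] := pow248_bound c.
have y4 : 0 <= y ^+ 4 := even_ge0 y 2.
have h2 := amgm2 (a * c * y) (y ^+ 2); rewrite -exprM /= in h2.
have h3 := sqr_amgm2 (a * c) y; have h4 := pow4_amgm2 a c.
have -> : a * c * (4 * y ^+ 3) = 4 * (a * c * y * y ^+ 2) by ring.
rewrite normrM normr_nat; lra.
Qed.

Lemma bound_Z a c z : `|a * a * c * (2 * z)| <= 2 * (1 + a ^+ 16 + c ^+ 16 + z ^+ 2).
Proof.
have [[a2 a4 a8 a16] [d2 d4 d8]] := pow248_bound a.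
have [[c2 c4 c8 c16] [e2 e4 e8]] := pow248_bound c.
have z2 := sqr_ge0 z.
have h2 := amgm2 (a ^+ 2 * c) z.
have h3 := sqr_amgm2 (a ^+ 2) c; rewrite -exprM /= in h3.
have -> : a * a * c * (2 * z) = 2 * (a ^+ 2 * c * z) by ring.
rewrite normrM normr_nat; lra.
Qed.

End RealBounds.

(** * The proper function psi *)

Section Psi.
Context {R : realType} {m : nat}.
Local Notation N := (2 * m.+2)%N.
Local Notation expr := (@expr R m).

Definition Sq (e : expr) := Mul e e.
(** The sign [s] selects the 16th power of [eA'] or of its inverse. With both in [psi], p - q is
    bounded on sublevel sets on either side; [eC16] does the same for q. *)
Definition eA16 (s : R) : expr := Exp (Mul (Cst (s * 8)) (Add (Co iP) (Opp (Co iQ)))).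
Definition eC16 (s : R) : expr := Exp (Mul (Cst (s * 16)) (Co iQ)).

Definition psi0 : expr :=
  Add (Cst 1) (Add (Add (eA16 1) (eA16 (-1))) (Add (Add (eC16 1) (eC16 (-1)))
    (Add (Sq (Sq (Sq (Co iU)))) (Sq (Co iZ))))).
Definition psi1 (i : 'I_m) : expr := Add (Sq (Co (iX i))) (Sq (Sq (Co (iY i)))).

(* The powers are chosen so that each derivative E_a psi is bounded by a multiple *)
(* of psi through the inequality of arithmetic and geometric means.               *)
Definition psi (x : 'rV[R]_N) : R := eval x psi0 + \sum_i eval x (psi1 i).

Lemma Ck_psi k : Ck k setT psi.
Proof.
apply: CkD; first exact: openT.
  exact/Ck_eval/openT.
apply: Ck_sum => [|i]; first exact: openT.
exact/Ck_eval/openT.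
Qed.

Lemma partial_psi b x : partial (ord_of_idx b) psi x =
  eval x (dexpr b psi0) + \sum_i eval x (dexpr b (psi1 i)).
Proof.
have ds : differentiable (fun x : 'rV[R]_N => \sum_i eval x (psi1 i)) x.
  by apply: differentiable_bigsum => i; exact: differentiable_eval.
apply: etrans (partialD _ (differentiable_eval psi0 x) ds) _.
rewrite partial_eval; congr (_ + _).
apply: etrans (partial_sum _ _) _ => [i|]; first exact: differentiable_eval.
by apply: eq_bigr => i _; rewrite partial_eval.
Qed.

Lemma eA16E x : eval x (eA16 1) = (eval x eA') ^+ 16.
Proof. by rewrite /= -expRM_natl; congr expR; field. Qed.

Lemma eC16E x : eval x (eC16 1) = (eval x eC') ^+ 16.
Proof. by rewrite /= -expRM_natl; congr expR; ring. Qed.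

Local Notation co x a := (x 0 (ord_of_idx a)).

Lemma psi1_ge0 x i : 0 <= eval x (psi1 i).
Proof. by rewrite /= addr_ge0 // -!expr2 sqr_ge0. Qed.

Lemma psi_ge (x : 'rV[R]_N) :
  [/\ 1 <= psi x, eval x (eA16 1) <= psi x, eval x (eA16 (-1)) <= psi x,
      eval x (eC16 1) <= psi x & eval x (eC16 (-1)) <= psi x] /\
  [/\ 1 + (eval x eA') ^+ 16 + (eval x eC') ^+ 16 + co x iU ^+ 8 + co x iZ ^+ 2 <= psi x &
      forall i, 1 + (eval x eA') ^+ 16 + (eval x eC') ^+ 16 + co x iU ^+ 8 + co x iZ ^+ 2
       + co x (iX i) ^+ 2 + co x (iY i) ^+ 4 <= psi x].
Proof.
rewrite -eA16E -eC16E.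
have s0 : 0 <= \sum_i eval x (psi1 i) by apply: sumr_ge0 => i _; exact: psi1_ge0.
have s1 i : eval x (psi1 i) <= \sum_i eval x (psi1 i).
  by rewrite (bigD1 i) //= lerDl; apply: sumr_ge0 => j _; exact: psi1_ge0.
have e1 i : eval x (psi1 i) = co x (iX i) ^+ 2 + co x (iY i) ^+ 4 by rewrite /=; ring.
have e0 : eval x psi0 = 1 + eval x (eA16 1) + eval x (eA16 (-1)) + eval x (eC16 1)
   + eval x (eC16 (-1)) + co x iU ^+ 8 + co x iZ ^+ 2 by rewrite /=; ring.
have p s : 0 < eval x (eA16 s) by exact: expR_gt0.
have p' s : 0 < eval x (eC16 s) by exact: expR_gt0.
have u8 : 0 <= co x iU ^+ 8 := even_ge0 _ 4; have z2 := sqr_ge0 (co x iZ).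
have := p 1; have := p (-1); have := p' 1; have := p' (-1).
rewrite /psi e0; move: (\sum_i _) s0 s1 => S s0 s1.
move: (eval x (eA16 1)) (eval x (eA16 (-1))) (eval x (eC16 1)) (eval x (eC16 (-1))).
move: (co x iU ^+ 8) (co x iZ ^+ 2) u8 z2 => u z u8 z2 a a' c c' *.
split; first by split; lra.
by split=> [|i]; last have := s1 i; rewrite ?e1; lra.
Qed.

Lemma partial_psiE x b : partial (ord_of_idx b) psi x =
  match b with
  | iP => 8 * (eval x (eA16 1) - eval x (eA16 (-1)))
  | iQ => 16 * (eval x (eC16 1) - eval x (eC16 (-1))) - 8 * (eval x (eA16 1) - eval x (eA16 (-1)))
  | iU => 8 * co x iU ^+ 7
  | iZ => 2 * co x iZ
  | iX i => 2 * co x (iX i)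
  | iY i => 4 * co x (iY i) ^+ 3
  end.
Proof.
rewrite partial_psi; case: b => [||||j|j].
1-4: by rewrite big1 => [|i _]; rewrite /=; ring.
- rewrite (eq_bigr (fun i => (j == i)%:R * (2 * co x (iX i)))) => [|i _].
    by rewrite (sum_delta j (fun i => 2 * co x (iX i))) /=; ring.
  by rewrite /= (eq_sym j); ring.
- rewrite (eq_bigr (fun i => (j == i)%:R * (4 * co x (iY i) ^+ 3))) => [|i _].
    by rewrite (sum_delta j (fun i => 4 * co x (iY i) ^+ 3)) /=; ring.
  by rewrite /= (eq_sym j); ring.
Qed.

Lemma frame_deriv_psi x a : `|frame_deriv (@frame R m) (ord_of_idx a) psi x| <= 32 * psi x.
Proof.
have -> : frame_deriv (@frame R m) (ord_of_idx a) psi x =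
   Eact x a (fun b => partial (ord_of_idx b) psi x).
  rewrite -sum_frame /frame_deriv big_ord_idx; apply: eq_bigr => b _.
  by rewrite frameE.
have [[p1 pA pA' pC pC'] [pP pX]] := psi_ge x.
have A0 : 0 < eval x (eA16 1) by exact: expR_gt0.
have A0' : 0 < eval x (eA16 (-1)) by exact: expR_gt0.
have C0 : 0 < eval x (eC16 1) by exact: expR_gt0.
have C0' : 0 < eval x (eC16 (-1)) by exact: expR_gt0.
have a16 : 0 <= eval x eA' ^+ 16 := even_ge0 _ 8.
have c16 : 0 <= eval x eC' ^+ 16 := even_ge0 _ 8.
have u8 : 0 <= co x iU ^+ 8 := even_ge0 _ 4; have z2 := sqr_ge0 (co x iZ).
case: a => [||||i|i]; rewrite /Eact !partial_psiE.
- by rewrite ler_norml; apply/andP; split; lra.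
- by rewrite ler_norml; apply/andP; split; lra.
- have := bound_U (eval x eC') (co x iU).
  have -> : eval x eC' * (8 * co x iU ^+ 7) = 8 * (eval x eC' * co x iU ^+ 7) by ring.
  rewrite (normrM 8) normr_nat; lra.
- have := bound_Z (eval x eA') (eval x eC') (co x iZ); lra.
- have y4 : 0 <= co x (iY i) ^+ 4 := even_ge0 _ 2.
  have := bound_X (eval x eA') (co x iU) (co x (iX i)) (co x (iY i)) (co x iZ).
  have := pX i; rewrite [eval x (Co iU)]/= [eval x (Co (iY i))]/=; lra.
- have y4 : 0 <= co x (iY i) ^+ 4 := even_ge0 _ 2; have x2 := sqr_ge0 (co x (iX i)).
  have := bound_Y (eval x eA') (eval x eC') (co x (iY i)); have := pX i; lra.
Qed.

(** In the orthonormal frame each component of [v] is at most its length; summing over the frame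
    gives the factor [N]. *)
Lemma psi_gradient x (v : 'rV[R]_N) :
  `|\sum_i v 0 i * partial i psi x| <=
  (32 * N%:R) * psi x * Num.sqrt ((v *m metric x *m v^T) 0 0).
Proof.
pose w := v *m coframe x.
have -> : \sum_i v 0 i * partial i psi x =
   \sum_a w 0 a * frame_deriv (@frame R m) a psi x.
  have wE i : v 0 i = \sum_a w 0 a * frame x a i.
    by rewrite -mulmx_coef /w -mulmxA coframeK mulmx1.
  under eq_bigr do rewrite wE mulr_suml.
  rewrite exchange_big; apply: eq_bigr => a _ /=.
  by rewrite /frame_deriv mulr_sumr; apply: eq_bigr => i _; rewrite mulrA.
rewrite metric_sqr -/w; set s := Num.sqrt _.
have s0 : 0 <= s by exact: sqrtr_ge0.
have ws a : `|w 0 a| <= s.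
  rewrite -(sqrtr_sqr (w 0 a)) ler_wsqrtr // (bigD1 a) //= lerDl.
  by apply: sumr_ge0 => b _; exact: sqr_ge0.
have p0 : 0 <= psi x by have [[p1 _ _ _ _] _] := psi_ge x; exact: le_trans ler01 p1.
apply: le_trans (ler_norm_sum _ _ _) _.
apply: (@le_trans _ _ (\sum_(a < N) s * (32 * psi x))).
  apply: ler_sum => a _; rewrite normrM ler_pM //.
  by rewrite -(idx_of_ordK a); exact: frame_deriv_psi.
rewrite sumr_const card_ord -mulr_natl le_eqVlt; apply/orP; left; apply/eqP; ring.
Qed.

(** Sublevel sets of [psi] lie in cubes; for p and q this uses 1 + s <= exp s with both signs of
    s. *)
Lemma psi_coord_bound (x : 'rV[R]_N) i : `|x 0 i| <= psi x.
Proof.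
have [[p1 pA pA' pC pC'] [pP pX]] := psi_ge x.
have a16 : 0 <= eval x eA' ^+ 16 := even_ge0 _ 8.
have c16 : 0 <= eval x eC' ^+ 16 := even_ge0 _ 8.
have u8 : 0 <= co x iU ^+ 8 := even_ge0 _ 4; have z2 := sqr_ge0 (co x iZ).
have ge1 (s : R) : 1 + s <= expR s := expR_ge1Dx s.
have hA := ge1 (1 * 8 * (co x iP + -1 * co x iQ)).
have hA' := ge1 (-1 * 8 * (co x iP + -1 * co x iQ)).
have hC := ge1 (1 * 16 * co x iQ).
have hC' := ge1 (-1 * 16 * co x iQ).
rewrite /= in pA pA' pC pC'.
have n1 (t : R) : `|t| <= (1 + t ^+ 2) / 2.
  by rewrite ler_norml; have h1 := sqr_ge0 (t - 1); have h2 := sqr_ge0 (t + 1); apply/andP; split; nra.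
rewrite -(idx_of_ordK i); case: (idx_of_ord i) => [||||j|j].
- by rewrite ler_norml; apply/andP; split; lra.
- by rewrite ler_norml; apply/andP; split; lra.
- have := n1 (co x iU); have := sqr_le1 (co x iU ^+ 2).
  by have := sqr_le1 (co x iU ^+ 4); rewrite -!exprM /=; lra.
- by have := n1 (co x iZ); lra.
- have y4 : 0 <= co x (iY j) ^+ 4 := even_ge0 _ 2.
  by have := n1 (co x (iX j)); have := pX j; lra.
- have x2 := sqr_ge0 (co x (iX j)).
  have := n1 (co x (iY j)); have := sqr_le1 (co x (iY j) ^+ 2).
  by rewrite -!exprM /=; have := pX j; lra.
Qed.

End Psi.

(** * Paths, Riemannian distance and a completeness criterion *)

Section PathLength.
Context {R : realType} {d : nat} {M : manifold R d} (g : components M).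

Lemma path_length_ge0 p q l : path_length g p q l -> 0 <= l.
Proof.
elim=> [//|gamma ell r l' _ [speed [sE I]] _ IH]; apply: addr_ge0 => //.
rewrite -lee_fin -I; apply: integral_ge0 => t t01; rewrite lee_fin.
have [a at'] := atlas_cover (gamma t).
by rewrite (sE t a _ at') ?sqrtr_ge0 // inE.
Qed.

Lemma path_length_trans p q r l l' :
  path_length g p q l -> path_length g q r l' -> path_length g p r (l + l').
Proof.
move=> H; elim: H l' => [p' l' H|gamma ell q' l1 C1 cl H IH l' H']; first by rewrite add0r.
by rewrite -addrA; apply: path_cons => //; exact: IH.
Qed.

Lemma path_length_lbound p q : has_lbound [set l | path_length g p q l].
Proof. by exists 0 => l /=; exact: path_length_ge0. Qed.

Lemma riemannian_dist_le p q l : path_length g p q l -> riemannian_dist g p q <= l.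
Proof. by move=> H; apply: ge_inf => //; exact: path_length_lbound. Qed.

Hypothesis connect : forall p q, exists l, path_length g p q l.

(** Needs [connect]: an infimum over an empty set of lengths would produce no path. *)
Lemma riemannian_dist_lt p q e : riemannian_dist g p q < e ->
  exists2 l, path_length g p q l & l < e.
Proof.
move=> de.
have hi : has_inf [set l | path_length g p q l].
  by split; [exact: connect|exact: path_length_lbound].
have e0 : 0 < e - riemannian_dist g p q by rewrite subr_gt0.
have [l pl le] := inf_adherent e0 hi; exists l => //.
by apply: lt_le_trans le _; rewrite /riemannian_dist subrKC.
Qed.

(** [F] grows at most linearly with length, so the tail of a Cauchy sequence stays in a sublevel set
    and has a cluster point. The last hypothesis says that short paths reach [p] from a whole
    neighbourhood, which makes it a limit for the distance. *)
Lemma complete_criterion (F : M -> R) (C : R) :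
  (forall p q l, path_length g p q l -> F q <= F p + C * l) -> 0 <= C ->
  (forall K : R, exists2 A : set M, compact A & forall p, F p <= K -> A p) ->
  (forall (p : M) (e : R), 0 < e -> \forall q \near p, exists2 l, path_length g q p l & l < e) ->
  complete_metric g.
Proof.
move=> FC C0 Fcpt near_p u cau.
have [N0 HN0] := cau 1 ltr01.
have [A cA FA] := Fcpt (F (u N0) + C).
have uA i : (N0 <= i)%N -> A (u i).
  move=> Ni; apply: FA; have [l pl l1] := riemannian_dist_lt (HN0 N0 i (leqnn _) Ni).
  apply: le_trans (FC _ _ _ pl) _; rewrite lerD2l -[leRHS]mulr1.
  by apply: ler_wpM2l => //; exact: ltW.
have [p [_ clp]] : A `&` cluster (u @ \oo) !=set0.
  by apply: cA; exists N0 => // i /=; exact: uA.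
exists p => e e0; have e20 : 0 < e / 2 by rewrite divr_gt0.
have [N1 HN1] := cau _ e20.
have [q [[j Nj <-] [l' pl' l'e]]] : ([set u i | i in [set i | (N1 <= i)%N]] `&`
    [set q | exists2 l, path_length g q p l & l < e / 2]) !=set0.
  apply: clp; last exact: near_p.
  by exists N1 => // i /= Ni; exists i.
exists N1 => i Ni; have [l pl le] := riemannian_dist_lt (HN1 i j Ni Nj).
apply: le_lt_trans (riemannian_dist_le (path_length_trans pl pl')) _.
by rewrite [e]splitr ltrD.
Qed.

End PathLength.

Section Continuity.
Context {R : realType}.

Lemma continuous_bigsum n (f : 'I_n -> R -> R) :
  (forall i, continuous (f i)) -> continuous (fun t => \sum_i f i t).
Proof.
move=> cf; rewrite -[X in continuous X]/(fun t => \sum_(i <- index_enum 'I_n) f i t).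
elim: (index_enum _) => [|i s IH] t.
  by under eq_fun do rewrite big_nil; exact: cst_continuous.
by under eq_fun do rewrite big_cons; apply: continuousD; [exact: cf|exact: IH].
Qed.

End Continuity.

(** * The model manifold and its completeness *)

Section Model.
Context {R : realType} (m : nat).
Local Notation N := (2 * m.+2)%N.

(** Transparent, so that transition maps reduce to the identity by computation. *)
Definition id_chart d : chart R d 'rV[R]_d.
Proof.
refine (@Chart R d 'rV[R]_d setT setT id id openT openT _ _ _ _) => //.
- by move=> x _; exact: cvg_id.
- by move=> x _; exact: cvg_id.
Defined.

Lemma id_atlas_smooth d (a b : unit) :
  smooth_on (transition_dom (id_chart d) (id_chart d)) (transition (id_chart d) (id_chart d)).
Proof.
have -> : transition_dom (id_chart d) (id_chart d) = setT by apply/seteqP; split.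
apply/smooth_onP => k; apply/Ck_mxP; first exact: openT.
by move=> i j; rewrite (ord1 i); apply: Ck_coord.
Qed.

Definition euclidean_manifold d : manifold R d :=
  @Manifold R d 'rV[R]_d (@rV_hausdorff R d) (@rV_second_countable R d) (@rV_connected R d)
    unit (fun=> id_chart d) (fun p => ex_intro _ tt I) (@id_atlas_smooth d).

Definition model := euclidean_manifold N.
Definition model_metric : components model := fun=> metric.
Definition model_acs : components model := fun=> acs.

Lemma speed_continuous (gamma v : R -> 'rV[R]_N) :
  continuous gamma -> continuous v ->
  continuous (fun t => Num.sqrt ((v t *m metric (gamma t) *m (v t)^T) 0 0)).
Proof.
move=> cg cv.
have c1 a : continuous (fun t => (v t *m coframe (gamma t)) 0 a : R).
  rewrite (_ : (fun t => _) = (fun t => \sum_i v t 0 i * coframe (gamma t) i a)); last first.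
    by apply/funext => t; rewrite mulmx_coef.
  apply: continuous_bigsum => i t; apply: continuousM.
    by apply: (@continuous_comp _ _ _ v (fun w : 'rV[R]_N => w 0 i : R)); [exact: cv|exact: coord_continuous].
  apply: (@continuous_comp _ _ _ gamma (fun y => coframe y i a : R)); first exact: cg.
  apply: differentiable_continuous.
  exact: ((differentiable_mxP _ _).1 ((Ck_coframe 0).1 _ I)).
have c2 : continuous (fun t => (v t *m metric (gamma t) *m (v t)^T) 0 0 : R).
  rewrite (_ : (fun t => _) = (fun t => \sum_a ((v t *m coframe (gamma t)) 0 a *
      (v t *m coframe (gamma t)) 0 a))); last first.
    by apply/funext => t; rewrite metric_sqr; apply: eq_bigr => a _; rewrite expr2.
  by apply: continuous_bigsum => a t; apply: continuousM; exact: c1.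
by move=> t; apply: (@continuous_comp _ _ _ _ Num.sqrt); [exact: c2|exact: sqrt_continuous].
Qed.

(** Along a curve the derivative of ln psi is d psi / psi, which [psi_gradient] bounds by a constant
    times the speed. *)
Lemma model_path_increment p q l : path_length model_metric p q l ->
  ln (psi q) <= ln (psi p) + (32 * N%:R) * l.
Proof.
elim=> [r|gamma ell r l' [cg C1] [speed [sE I1]] _ IH].
  by rewrite mulr0 addr0.
apply: le_trans IH _; rewrite [X in _ <= _ + X]mulrDr addrA lerD2r.
have [dg cdg] : (forall t, derivable (gamma : R -> 'rV[R]_N) t 1) /\
   continuous (derive1 (gamma : R -> 'rV[R]_N)).
  have E : in_chart (tt : atlas_index model) gamma = (gamma : R -> 'rV[R]_N) by [].
  split=> t; have := C1 tt t I; rewrite E; first by case.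
  by case=> _; exact.
pose v := derive1 (gamma : R -> 'rV[R]_N).
pose s t := Num.sqrt ((v t *m metric (gamma t) *m (v t)^T) 0 0).
have psi0 (x : 'rV[R]_N) : 0 < psi x by have [[p1 _ _ _ _] _] := psi_ge x; exact: lt_le_trans ltr01 p1.
pose F' t := (psi (gamma t))^-1 * \sum_i v t 0 i * partial i psi (gamma t).
have dpsi (x : 'rV[R]_N) : differentiable psi x := (Ck_psi 0).1 x I.
have dF (t : R) : is_derive t (1 : R) (fun t => ln (psi (gamma t))) (F' t).
  have dgt : differentiable (gamma : R -> 'rV[R]_N) t by exact/derivable1_diffP/dg.
  have D1 : is_derive t (1 : R) (fun t => psi (gamma t)) (\sum_i v t 0 i * partial i psi (gamma t)).
    have dc := differentiable_comp dgt (dpsi (gamma t)).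
    apply: DeriveDef; first exact: diff_derivable dc.
    rewrite deriveE // (diff_comp dgt (dpsi _)) /=.
    have -> : 'd (gamma : R -> 'rV[R]_N) t 1 = v t by rewrite /v derive1E deriveE.
    rewrite {1}(row_sum_delta (v t)) linear_sum; apply: eq_bigr => i _.
    by rewrite linearZ /= -partialE.
  have D2 := is_derive1_ln (psi0 (gamma t)).
  exact: is_derive1_comp.
have cF1 : continuous (fun t => (psi (gamma t))^-1 : R).
  move=> t; have c0 : {for t, continuous (fun t => psi (gamma t) : R)}.
    apply: (@continuous_comp _ _ _ gamma psi); first exact: cg.
    exact: differentiable_continuous.
  by apply: (cvgV _ c0); rewrite gt_eqF.
have cF2 : continuous (fun t => \sum_i v t 0 i * partial i psi (gamma t) : R).
  apply: continuous_bigsum => i.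
  have c1 : continuous (fun t => v t 0 i : R).
    move=> t; apply: (@continuous_comp _ _ _ v (fun w : 'rV[R]_N => w 0 i : R)); first exact: cdg.
    exact: coord_continuous.
  have c2 : continuous (fun t => partial i psi (gamma t) : R).
    move=> t; apply: (@continuous_comp _ _ _ gamma (partial i psi)); first exact: cg.
    by apply: differentiable_continuous; exact: ((Ck_psi 1).2 i).1.
  by move=> t; exact: (continuousM (c1 t) (c2 t)).
have cF : continuous F' by move=> t; exact: (continuousM (cF1 t) (cF2 t)).
have cs : continuous s by apply: speed_continuous.
have Fs t : 0 <= t <= 1 -> `|F' t| <= 32 * N%:R * s t.
  move=> _; have p0 := psi0 (gamma t).
  rewrite /F' normrM (ger0_norm (ltW _)) ?invr_gt0 // mulrC ler_pdivrMr //.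
  by rewrite mulrAC; exact: psi_gradient.
have I2 : (\int[lebesgue_measure]_(t in `[0%R, 1%R]) (s t)%:E = ell%:E)%E.
  rewrite -I1; apply: eq_integral => t t01; congr (_%:E).
  by rewrite (sE t tt) // -in_setE.
have := increment_le_integral dF cF cs Fs I2.
by rewrite ler_norml => /andP[_]; rewrite lerBlDl.
Qed.

Lemma model_path_segment (p q : 'rV[R]_N) :
  exists2 l, path_length model_metric p q l &
    forall c, 0 <= c -> (forall t, 0 <= t <= 1 ->
     (((q - p) *m metric (p + t *: (q - p)) *m (q - p)^T) 0 0) <= c ^+ 2) -> l <= c.
Proof.
pose gamma (t : R) : 'rV[R]_N := p + t *: (q - p).
have dg (t : R) : is_derive t (1 : R) gamma (q - p).
  have := @is_derive_line R 'rV[R]_N 'rV[R]_N id p (q - p) t (@derivable_id _ _ _ _).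
  by rewrite derive_id.
have d1 : derive1 gamma = fun=> q - p.
  by apply/funext => t; rewrite derive1E; have [_ ->] := dg t.
have cg : continuous gamma.
  move=> t; apply: differentiable_continuous; apply/derivable1_diffP.
  by have [] := dg t.
have cv : continuous (fun _ : R => q - p : 'rV[R]_N) by move=> t; exact: cvg_cst.
pose s t := Num.sqrt (((q - p) *m metric (gamma t) *m (q - p)^T) 0 0).
have cs : continuous s by exact: (speed_continuous cg cv).
have [l lE lc] := itv01_integral_le cs.
exists l; last first.
  move=> c c0 bnd; apply: lc => t /bnd H.
  by rewrite -(ger0_norm c0) -sqrtr_sqr ler_wsqrtr.
have g0 : gamma 0 = p by rewrite /gamma scale0r addr0.
have g1 : gamma 1 = q by rewrite /gamma scale1r subrKC.
rewrite -[l]addr0 -{1}g0; apply: path_cons; last by rewrite g1; exact: path_nil.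
  split=> // a t _; split; first by have [] := dg t.
  have -> : derive1 (in_chart a gamma) = fun=> q - p by exact: d1.
  exact: cvg_cst.
exists s; split=> // t a t01 _ /=.
have -> : derive1 (in_chart a gamma) = fun=> q - p by exact: d1.
by [].
Qed.

Lemma metric_bound (p : 'rV[R]_N) : exists2 C, 0 <= C &
  \forall q \near p, forall v : 'rV[R]_N, (v *m metric q *m v^T) 0 0 <= (C * `|v|) ^+ 2.
Proof.
have ce (x : 'rV[R]_N) i : `|x 0 i| <= `|x|.
  rewrite [leRHS]/Num.Def.normr /= mx_normrE.
  exact: (le_bigmax _ (fun ij : 'I_1 * 'I_N => `|x ij.1 ij.2|) (0, i)).
have ceM (x : 'M[R]_N) i j : `|x i j| <= `|x|.
  rewrite [leRHS]/Num.Def.normr /= mx_normrE.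
  exact: (le_bigmax _ (fun ij : 'I_N * 'I_N => `|x ij.1 ij.2|) (i, j)).
pose K := `|coframe p| + 1.
have K0 : 0 <= K by rewrite addr_ge0.
(* One factor [N] bounds a component of [v *m coframe q]; the other covers the sum of [N] squares,
   as N <= N^2. *)
exists (N%:R * (N%:R * K)); first by rewrite !mulr_ge0.
have cc : {for p, continuous (@coframe R m)}.
  by apply: differentiable_continuous; exact: (Ck_coframe 0).1.
have : \forall q \near p, `|coframe p - coframe q| < 1.
  by move/cvgrPdist_lt: cc; apply; exact: ltr01.
apply: filterS => q pq v; rewrite metric_sqr.
have qK : `|coframe q| <= K.
  rewrite -[coframe q](subKr (coframe p)); apply: le_trans (ler_normB _ _) _.
  by rewrite lerD2l ltW.
have va a : (v *m coframe q) 0 a ^+ 2 <= (N%:R * K * `|v|) ^+ 2.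
  rewrite -real_normK ?num_real // ler_pXn2r ?nnegrE ?mulr_ge0 //.
  rewrite mulmx_coef; apply: le_trans (ler_norm_sum _ _ _) _.
  apply: (@le_trans _ _ (\sum_(i < N) (K * `|v|))).
    apply: ler_sum => i _; rewrite normrM mulrC ler_pM //.
    exact: le_trans (ceM _ _ _) qK.
  by rewrite sumr_const card_ord -[X in X <= _]mulr_natl mulrA.
apply: le_trans (ler_sum _ (fun a _ => va a)) _.
rewrite sumr_const card_ord -[X in X <= _]mulr_natl -[in leRHS]mulrA [in leRHS]exprMn.
rewrite ler_wpM2r ?sqr_ge0 // expr2 -natrM ler_nat leq_pmulr //.
Qed.

Lemma model_near (p : model) (e : R) : 0 < e ->
  \forall q \near p, exists2 l, path_length model_metric q p l & l < e.
Proof.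
move=> e0; have [C C0 /nbhs_ballP[r /= r0 rC]] := metric_bound p.
(* The segment then stays in the ball where [C] is valid; [C + 1] keeps the denominator positive
   when [C] is 0. *)
pose r' := Num.min r (e / (C + 1)).
have C1 : 0 < C + 1 by rewrite ltr_wpDl.
have r'0 : 0 < r' by rewrite lt_min r0 divr_gt0.
apply/nbhs_ballP; exists r' => // q; rewrite -ball_normE /= => pq.
have [l pl lc] := model_path_segment q p.
have le : l <= C * `|p - q : 'rV[R]_N|.
  apply: lc; first exact: mulr_ge0.
  move=> t /andP[t0 t1]; apply: rC; rewrite -ball_normE /=.
  have -> : (p : 'rV[R]_N) - (q + t *: (p - q)) = (1 - t) *: (p - q).
    by rewrite scalerBl scale1r opprD addrA.
  rewrite normrZ ger0_norm ?subr_ge0 //.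
  apply: (@le_lt_trans _ _ `|p - q : 'rV[R]_N|).
    by rewrite -[leRHS]mul1r ler_wpM2r // lerBlDr lerDl.
  by apply: lt_le_trans pq _; rewrite ge_min lexx.
exists l => //; apply: le_lt_trans le _.
apply: (@le_lt_trans _ _ ((C + 1) * `|p - q : 'rV[R]_N|)).
  by rewrite ler_wpM2r // lerDl.
rewrite mulrC -ltr_pdivlMr //; apply: lt_le_trans pq _.
by rewrite ge_min lexx orbT.
Qed.

Lemma model_complete : complete_metric model_metric.
Proof.
have psi0 (x : 'rV[R]_N) : 0 < psi x.
  by have [[p1 _ _ _ _] _] := psi_ge x; exact: lt_le_trans ltr01 p1.
apply: (@complete_criterion R N model model_metric _ (fun p => ln (psi p)) (32 * N%:R)).
- by move=> p q; have [l] := model_path_segment p q; exists l.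
- by move=> p q l; exact: model_path_increment.
- by rewrite mulr_ge0.
- move=> K; exists [set x : 'rV[R]_N | forall i, x 0 i \in `[- expR K, expR K]].
    apply: (@rV_compact R N (fun=> `[- expR K, expR K]%classic)) => i.
    exact: segment_compact.
  move=> p pK i; rewrite in_itv /= -ler_norml.
  apply: le_trans (psi_coord_bound _ _) _.
  by rewrite -[psi p]lnK ?posrE // ler_expR.
- exact: model_near.
Qed.

End Model.

Section ModelStructure.
Context {R : realType} (m : nat).
Local Notation N := (2 * m.+2)%N.

Lemma jacobian_id d (x : 'rV[R]_d) : 'J id x = 1%:M.
Proof.
apply/matrixP => i j; rewrite jacobianE; last first.
  by apply/differentiable_mxP => a b; exact: differentiable_coord.
by rewrite partial_coord mxE eq_sym.
Qed.

Lemma model_transitionE (a b : atlas_index (@model R m)) (x : 'rV[R]_N) :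
  'J (transition (atlas a) (atlas b)) x = 1%:M.
Proof. exact: jacobian_id. Qed.

Lemma model_riemannian : riemannian_metric (@model_metric R m).
Proof.
split=> [a|a b x _ f].
  split; first exact: smooth_metric.
  by move=> x _; split; [exact: metric_tr|exact: metric_gt0].
by rewrite /f model_transitionE mul1mx trmx1 mulmx1.
Qed.

Lemma model_almost_complex : almost_complex (@model_acs R m).
Proof.
split=> [a|]; first exact: smooth_acs.
split=> [a x _|a b x _ f]; first exact: acs_sqr.
by rewrite /f model_transitionE mul1mx mulmx1.
Qed.

Lemma model_almost_kahler : almost_kahler (@model_metric R m) (@model_acs R m).
Proof.
split.
- exact: model_riemannian.
- exact: model_almost_complex.
- by move=> a x _; exact: acs_orth.
- by move=> a; exact: closed_fundamental.
Qed.

Lemma model_einstein : einstein (@model_metric R m).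
Proof. by exists (- (1 + m%:R / 2)) => a x _; exact: ricci_metric. Qed.

Lemma model_not_integrable : (0 < m)%N -> ~ Defs.integrable (@model_acs R m).
Proof.
move=> m0 H; have [a [U [k [V [f [f' [[_ Ux] _ diff JE]]]]]]] := H (0 : 'rV[R]_N).
exact: (acs_not_integrable m0 Ux diff JE).
Qed.

Lemma model_irreducible : (0 < m)%N -> irreducible_metric (@model_metric R m).
Proof.
move=> m0 p [a [U [k [l [V1 [V2 [h1 [h2 [f [f' [[_ Ux] _ [k0 l0] _ [diff gE]]]]]]]]]]]].
exact: (metric_not_product m0 k0 l0 Ux diff gE).
Qed.

End ModelStructure.

Theorem mainTheorem4 (R : realType) (n : nat) (hn : (4 < 2 * n)%N) :
  exists (M : manifold R (2 * n)) (g J : components M),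
    strictly_almost_kahler g J /\ einstein g /\ complete_metric g /\
    irreducible_metric g.
Proof.
(* The hypothesis leaves n = m + 3, so the model has n - 2 = m + 1 > 0 pairs X_i, Y_i. *)
case: n hn => [|[|[|m]]] // _.
exists (@model R m.+1), (@model_metric R m.+1), (@model_acs R m.+1); split.
  by split; [exact: model_almost_kahler|exact: model_not_integrable].
split; first exact: model_einstein.
by split; [exact: model_complete|exact: model_irreducible].
Qed.
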